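(* There exists a $(2,2)$-periodic function $Q:\mathcal{V}_{\mathrm{tri}}\to\mathbb{R}$ such that $\sigma(\Delta_{\mathrm{tri}}+\lambda Q)$ has exactly two connected components for all sufficiently small $\lambda>0$.
   Context: Triangular lattice: let $\bm{a}_1=(1,0)$, $\bm{a}_2=\frac12(1,\sqrt3)$ in $\mathbb{R}^2$ and $\mathcal{V}_{\mathrm{tri}}=\{n\bm{a}_1+m\bm{a}_2:n,m\in\mathbb{Z}\}$; vertices $u,v$ are neighbors, $u\sim v$, iff their Euclidean distance is $1$. The Laplacian $\Delta_{\mathrm{tri}}$ is the bounded self-adjoint operator on $\ell^2(\mathcal{V}_{\mathrm{tri}})$ given by $[\Delta_{\mathrm{tri}}\psi]_u=\sum_{v\sim u}\psi_v$ (the adjacency operator). A bounded function $Q:\mathcal{V}_{\mathrm{tri}}\to\mathbb{R}$ acts by multiplication, $[Q\psi]_u=Q(u)\psi_u$. $Q$ is $(p_1,p_2)$-periodic if $Q(u+p_1\bm{a}_1)=Q(u+p_2\bm{a}_2)=Q(u)$ for all $u\in\mathcal{V}_{\mathrm{tri}}$. $\sigma$ denotes spectrum. *)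

(* Defs.v *)
From HB Require Import structures.
From mathcomp Require Import all_boot all_order all_algebra.
From mathcomp Require Import complex.
From mathcomp Require Import all_classical all_reals all_analysis.

Set Implicit Arguments.
Unset Strict Implicit.
Unset Printing Implicit Defensive.

Import Order.TTheory GRing.Theory Num.Theory.
Import numFieldNormedType.Exports.

Local Open Scope classical_set_scope.
Local Open Scope ring_scope.

(* R[i] packaged as a numClosedFieldType, so that it carries the topology that
   MathComp-Analysis puts on the sort of every numFieldType. *)
Definition Cplx (R : realType) : numClosedFieldType := R[i].

Definition Cmod (R : realType) (z : Cplx R) : R := ComplexField.Normc.normc z.

Definition Cinj (R : realType) (x : R) : Cplx R := x%:C%C.

Section Ell2.
Variables (R : realType) (V : choiceType).

Definition sqnorm2 (psi : V -> Cplx R) : \bar R :=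
  \esum_(u in [set: V]) (Cmod (psi u) ^+ 2)%:E.

Definition ell2 : set (V -> Cplx R) := [set psi | (sqnorm2 psi < +oo)%E].

(* Operators are given by their values on all functions V -> C; only their
   restriction to ell2 matters.  The norm bound implies that ell2 is stable
   under T. *)
Definition bounded_operator (T : (V -> Cplx R) -> V -> Cplx R) : Prop :=
  (forall (a : Cplx R) (phi psi : V -> Cplx R), ell2 phi -> ell2 psi ->
     T (fun u => a * phi u + psi u) = (fun u => a * T phi u + T psi u)) /\
  (exists M : R, forall psi, ell2 psi ->
     (sqnorm2 (T psi) <= M%:E * sqnorm2 psi)%E).

(* For T bounded on ell2: z is in the resolvent set iff T - z has a two-sided
   inverse among the bounded operators on ell2. *)
Definition resolvent_set (T : (V -> Cplx R) -> V -> Cplx R) : set (Cplx R) :=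
  [set z | exists S : (V -> Cplx R) -> V -> Cplx R, bounded_operator S /\
    forall psi, ell2 psi ->
      (fun u => T (S psi) u - z * S psi u) = psi /\
      S (fun u => T psi u - z * psi u) = psi].

Definition spectrum (T : (V -> Cplx R) -> V -> Cplx R) : set (Cplx R) :=
  ~` resolvent_set T.

End Ell2.

Definition components (X : topologicalType) (A : set X) : set (set X) :=
  [set connected_component A x | x in A].

Section Triangular.
Variable R : realType.

Definition tri_a1 : R * R := (1, 0).
Definition tri_a2 : R * R := (2^-1, 2^-1 * Num.sqrt 3).

Definition tri_lattice : set (R * R) :=
  [set p | exists n m : int, p = tri_a1 *~ n + tri_a2 *~ m].

Definition tri_vertex : choiceType := tri_lattice.

(* The library's norm on R * R is the sup norm, hence this definition. *)
Definition euclid_dist (p q : R * R) : R :=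
  Num.sqrt ((p.1 - q.1) ^+ 2 + (p.2 - q.2) ^+ 2).

Definition tri_adj (u v : tri_vertex) : Prop :=
  euclid_dist (set_val u) (set_val v) = 1.

(* A \sum over a set is 0 by convention when its support is infinite; every
   vertex has six neighbours, so this convention is never used here. *)
Definition tri_laplacian (psi : tri_vertex -> Cplx R) (u : tri_vertex) :
    Cplx R :=
  \sum_(v \in [set v | tri_adj u v]) psi v.

Definition schrodinger (Q : tri_vertex -> R) (psi : tri_vertex -> Cplx R)
    (u : tri_vertex) : Cplx R :=
  tri_laplacian psi u + Cinj (Q u) * psi u.

Definition tri_periodic (p1 p2 : nat) (Q : tri_vertex -> R) : Prop :=
  (forall u v : tri_vertex,
     set_val v = set_val u + tri_a1 *+ p1 -> Q v = Q u) /\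
  (forall u v : tri_vertex,
     set_val v = set_val u + tri_a2 *+ p2 -> Q v = Q u).

End Triangular.

(* Main.v *)
(* Take [Q = -1] on the vertices with both coordinates even and [Q = 0]
   elsewhere.  On a Bloch wave of quasimomentum [(a, b)] the operator acts by a
   real symmetric 4 x 4 matrix whose off-diagonal entries are
   [X = 2 cos a], [Y = 2 cos b], [Z = 2 cos (a - b)], and the identity
   [X^2 + Y^2 + Z^2 = X Y Z + 4] turns its characteristic polynomial at
   [E = -2 - t] into
     [t^2 (t^2 + 8 t + 2 n) - p - lam t (t^2 + 6 t + n)],
   with [n = 12 - X^2 - Y^2 - Z^2 >= 0] and
   [p = (4 - X^2) (4 - Y^2) (4 - Z^2) >= 0].  This is negative for
   [0 < t <= lam / 2], which is a gap just below [E = -2]; for [t > 0] its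
   quotient by [t (t^2 + 6 t + n)] increases with [t], so the energies below the
   gap form one interval, and evaluating at three quasimomenta shows that the
   energies from [-2] up to the maximum form another one.

   To see that the spectrum is the set of [E] at which the polynomial vanishes
   for some [(a, b)]: at such an [E] the Bloch wave damped by
   [q^(|n| + |m|)] is an approximate eigenfunction as [q] tends to 1.
   Otherwise, writing [D] for the operator minus [E], Parseval's identity on
   large discrete tori gives [|D f| >= c |f|], and [D^2 + eta^2] is inverted by
   Richardson iteration, whose iteration operator has finite range, so that its
   contraction estimate passes from the tori to the lattice. *)
Require Import Defs.
From mathcomp Require Import all_boot all_order all_algebra.
From mathcomp Require Import fingroup perm complex finmap zify ring lra.
From mathcomp Require Import all_classical all_reals all_analysis.
Import numFieldNormedType.Exports.
Local Open Scope classical_set_scope.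
Local Open Scope ring_scope.

Set Implicit Arguments.
Unset Strict Implicit.
Unset Printing Implicit Defensive.

Import Order.TTheory GRing.Theory Num.Theory.

(** * Boxes in the square lattice *)

Definition oddz (n : int) : bool := odd `|n|%N.

Lemma oddzD (m n : int) : oddz (m + n) = oddz m (+) oddz n.
Proof. rewrite /oddz; lia. Qed.

Lemma oddzN (n : int) : oddz (- n) = oddz n.
Proof. by rewrite /oddz abszN. Qed.

(** In the coordinates [(n, m)] of [n a_1 + m a_2], the six neighbours of the origin are these three
    steps and their opposites. *)
Definition step1 : int * int := (1, 0).
Definition step2 : int * int := (0, 1).
Definition step3 : int * int := (1, -1).

Definition cls (x : int * int) : bool * bool := (oddz x.1, oddz x.2).

(* The side [4 k + 4] is even, so that functions of the parities of the
   coordinates are periodic modulo the box. *)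
Definition boxpt k (i : 'I_(4 * k + 3).+1 * 'I_(4 * k + 3).+1) : int * int :=
  (i.1%:Z - (2 * k + 2)%:Z, i.2%:Z - (2 * k + 2)%:Z).

Arguments boxpt : clear implicits.

Section Hop.
Variable R : realType.
Implicit Types (f g w h : int * int -> R).

Definition hop f x : R :=
  (f (x + step1) + f (x - step1)) + (f (x + step2) + f (x - step2))
  + (f (x + step3) + f (x - step3)).

Definition hopw w f x : R := hop f x + w x * f x.

Definition box k h : R := \sum_i h (boxpt k i).

Definition boxper k h :=
  (forall x, h (x + ((4 * k + 4)%:Z, 0)) = h x) /\
  (forall x, h (x + (0, (4 * k + 4)%:Z)) = h x).

Lemma sum_shift (n : nat) (g : int -> R) (c : int) :
  (forall y, g (y + n.+1%:Z) = g y) ->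
  \sum_(i < n.+1) g (i%:Z + c + 1) = \sum_(i < n.+1) g (i%:Z + c).
Proof.
move=> gP; rewrite big_ord_recr [RHS]big_ord_recl /= addrC; congr (_ + _).
  rewrite -[RHS]gP; congr g; lia.
by apply: eq_bigr => i _; congr g; rewrite /bump /=; lia.
Qed.

Lemma pairD (a b c d : int) : (a, b) + (c, d) = (a + c, b + d).
Proof. by []. Qed.

Lemma boxE k h : box k h = \sum_i \sum_j h (boxpt k (i, j)).
Proof. by rewrite pair_bigA; apply: eq_bigr => -[i j] _. Qed.

Lemma box_step1 k h : boxper k h -> box k (fun x => h (x + step1)) = box k h.
Proof.
move=> [h1 h2]; rewrite !boxE exchange_big [RHS]exchange_big /=.
apply: eq_bigr => j _; rewrite /boxpt /step1 /=.
have := @sum_shift (4 * k + 3) (fun y => h (y, j%:Z - (2 * k + 2)%:Z)) (- (2 * k + 2)%:Z).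
under eq_bigr do rewrite pairD addr0.
apply => y; rewrite -[RHS]h1 pairD addr0; congr (h (_, _)); lia.
Qed.

Lemma box_step2 k h : boxper k h -> box k (fun x => h (x + step2)) = box k h.
Proof.
move=> [h1 h2]; rewrite !boxE.
apply: eq_bigr => j _; rewrite /boxpt /step1 /=.
have := @sum_shift (4 * k + 3) (fun y => h (j%:Z - (2 * k + 2)%:Z, y)) (- (2 * k + 2)%:Z).
under eq_bigr do rewrite pairD addr0.
apply => y; rewrite -[RHS]h2 pairD addr0; congr (h (_, _)); lia.
Qed.

Lemma boxper_shift k h s : boxper k h -> boxper k (fun x => h (x + s)).
Proof. by move=> [h1 h2]; split=> x; rewrite addrAC ?h1 ?h2. Qed.

Lemma box_step3 k h : boxper k h -> box k (fun x => h (x + step3)) = box k h.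
Proof.
move=> hP; have hP2 := boxper_shift (- step2) hP.
have e1 : box k (fun x => h (x + step3)) = box k (fun x => h (x - step2)).
  by rewrite -(box_step1 hP2); apply: eq_bigr => i _; rewrite -addrA.
by rewrite e1 -(box_step2 hP2); apply: eq_bigr => i _; rewrite addrK.
Qed.

Lemma boxperM k f g :
  boxper k f -> boxper k g -> boxper k (fun x => f x * g x).
Proof. by move=> [f1 f2] [g1 g2]; split=> x; rewrite ?f1 ?g1 ?f2 ?g2. Qed.

Lemma boxperD k f g :
  boxper k f -> boxper k g -> boxper k (fun x => f x + g x).
Proof. by move=> [f1 f2] [g1 g2]; split=> x; rewrite ?f1 ?g1 ?f2 ?g2. Qed.

Lemma boxper_hopw k w f :
  boxper k w -> boxper k f -> boxper k (hopw w f).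
Proof.
by move=> wP fP; do !apply: boxperD; try apply: boxperM => //;
  apply: boxper_shift.
Qed.

Lemma boxD k f g : box k (fun x => f x + g x) = box k f + box k g.
Proof. exact: big_split. Qed.

Lemma boxZ k c f : box k (fun x => c * f x) = c * box k f.
Proof. by rewrite /box mulr_sumr. Qed.

(** Shift invariance of the box sum moves a shift from one factor to the opposite shift of the
    other; this is what makes [hopw] self-adjoint on the torus. *)
Lemma box_adj k s f g : 
  (forall h, boxper k h -> box k (fun x => h (x + s)) = box k h) ->
  boxper k f -> boxper k g ->
  box k (fun x => (f (x + s) + f (x - s)) * g x) =
  box k (fun x => f x * (g (x + s) + g (x - s))).
Proof.
move=> sP fP gP.
have e1 : box k (fun x => f (x + s) * g x) = box k (fun x => f x * g (x - s)).
  rewrite -[RHS]sP; last exact/boxperM/boxper_shift.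
  by apply: eq_bigr => i _; rewrite addrK.
have e2 : box k (fun x => f (x - s) * g x) = box k (fun x => f x * g (x + s)).
  rewrite -[LHS]sP; last exact/boxperM/gP/boxper_shift.
  by apply: eq_bigr => i _; rewrite addrK.
under eq_fun do rewrite mulrDl; rewrite boxD e1 e2.
by under [in RHS]eq_fun do rewrite mulrDr; rewrite boxD addrC.
Qed.

Lemma hopw_sym k w f g : boxper k f -> boxper k g ->
  box k (fun x => hopw w f x * g x) = box k (fun x => f x * hopw w g x).
Proof.
move=> fP gP; rewrite /hopw /hop.
under eq_fun do rewrite 3!mulrDl.
under [in RHS]eq_fun do rewrite 3!mulrDr.
rewrite !boxD; congr (_ + _ + _ + _).
- exact/box_adj/gP/fP/box_step1.
- exact/box_adj/gP/fP/box_step2.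
- exact/box_adj/gP/fP/box_step3.
by apply: eq_bigr => i _; ring.
Qed.

End Hop.

(** * Discrete orthogonality of the trigonometric functions *)

Section Trig.
Variable R : realType.

Lemma cosDint (x : R) (m : int) : cos (x + (pi *+ 2) *~ m) = cos x.
Proof.
case: m => n; first by rewrite -pmulrn (periodicn (@cosD2pi R)).
rewrite NegzE mulrNz -pmulrn -[in RHS](subrK ((pi *+ 2) *+ n.+1) x).
by rewrite (periodicn (@cosD2pi R)).
Qed.

Lemma sinDint (x : R) (m : int) : sin (x + (pi *+ 2) *~ m) = sin x.
Proof. by rewrite -!cosBpihalf addrAC cosDint. Qed.

(* The pair of sums is fixed by the rotation of angle [t]. *)
Lemma sum_trig_eq0 (n : nat) (t : R) : cos t != 1 ->
    cos (t * n.+1%:R) = 1 -> sin (t * n.+1%:R) = 0 ->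
  \sum_(i < n.+1) cos (t * i%:R) = 0 /\ \sum_(i < n.+1) sin (t * i%:R) = 0.
Proof.
move=> t1 cn sn; set X := \sum_(i < _) cos _; set Y := \sum_(i < _) sin _.
have eX : X = X * cos t - Y * sin t.
  rewrite !mulr_suml -sumrB {1}/X big_ord_recl [RHS]big_ord_recr /= -cosD.
  rewrite mulr0 cos0 -{1}cn addrC -natr1 mulrDr mulr1; congr (_ + _).
  by apply: eq_bigr => i _; rewrite -cosD /bump /= add1n -natr1 mulrDr mulr1.
have eY : Y = Y * cos t + X * sin t.
  rewrite !mulr_suml -big_split {1}/Y big_ord_recl [RHS]big_ord_recr /= -sinD.
  rewrite mulr0 sin0 -{1}sn addrC -natr1 mulrDr mulr1.
  congr (_ + _).
  by apply: eq_bigr => i _; rewrite -sinD /bump /= add1n -natr1 mulrDr mulr1.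
have ct : 0 < 1 - cos t by rewrite subr_gt0 lt_neqAle t1 cos_le1.
(* Add [X] times the first relation to [Y] times the second: the sine terms cancel. *)
have h : (1 - cos t) * (X ^+ 2 + Y ^+ 2) = 0.
  move: (congr1 (fun z => X * z) eX) (congr1 (fun z => Y * z) eY); lra.
move/eqP: h; rewrite mulf_eq0 gt_eqF //= paddr_eq0 ?sqr_ge0 // !sqrf_eq0.
by move=> /andP[/eqP -> /eqP ->].
Qed.

Definition grid (n i : nat) : R := (pi *+ 2) * i%:R / n%:R.

Lemma sum_grid_nat (n d : nat) : (0 < d < n.+1)%N ->
  \sum_(i < n.+1) cos (grid n.+1 i * d%:R) = 0 /\
  \sum_(i < n.+1) sin (grid n.+1 i * d%:R) = 0.
Proof.
move=> /andP[d0 dn].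
set t : R := (pi *+ 2) * d%:R / n.+1%:R.
have tn : t * n.+1%:R = 0 + (pi *+ 2) *~ d%:Z.
  by rewrite /t divfK ?pnatr_eq0 // -pmulrn mulr_natr add0r.
have [] := @sum_trig_eq0 n t.
(* Half of [t] lies strictly between [0] and [pi], so its sine is positive and [cos t < 1]. *)
- have -> : t = (pi * (d%:R / n.+1%:R)) *+ 2 by rewrite /t; ring.
  rewrite cos_mulr2n cos2sin2 lt_eqF //.
  have : 0 < sin (pi * (d%:R / n.+1%:R) : R).
    apply: sin_gt0_pi; rewrite mulr_gt0 ?pi_gt0 ?divr_gt0 ?ltr0n //=.
    by rewrite gtr_pMr ?pi_gt0 // ltr_pdivrMr ?ltr0n // mul1r ltr_nat.
  move=> h; have := exprn_gt0 2 h; lra.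
- by rewrite tn cosDint cos0.
- by rewrite tn sinDint sin0.
move=> c s; split.
  rewrite -[RHS]c; apply: eq_bigr => i _; congr cos; rewrite /grid /t; ring.
rewrite -[RHS]s; apply: eq_bigr => i _; congr sin; rewrite /grid /t; ring.
Qed.

Lemma sum_cos_grid (n : nat) (d : int) : (`|d| < n.+1)%N ->
  \sum_(i < n.+1) cos (grid n.+1 i * d%:~R) = (d == 0)%:R * n.+1%:R.
Proof.
move=> dn; have [->|d0] := eqVneq d 0.
  under eq_bigr do rewrite mulr0 cos0.
  by rewrite sumr_const card_ord mul1r.
rewrite mul0r.
have [|c _] := @sum_grid_nat n `|d|%N; first by rewrite absz_gt0 d0.
rewrite -[RHS]c; apply: eq_bigr => i _; case: d {dn d0 c} => m //.
by rewrite NegzE abszN mulrNz mulrN cosN.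
Qed.

Lemma sum_sin_grid (n : nat) (d : int) : (`|d| < n.+1)%N ->
  \sum_(i < n.+1) sin (grid n.+1 i * d%:~R) = 0.
Proof.
move=> dn; have [->|d0] := eqVneq d 0.
  by under eq_bigr do rewrite mulr0 sin0; rewrite big1.
have [|_ c] := @sum_grid_nat n `|d|%N; first by rewrite absz_gt0 d0.
case: d {dn d0} c => m c; first by rewrite -[RHS]c.
apply/eqP; rewrite -oppr_eq0 -sumrN; apply/eqP; rewrite -[RHS]c.
by apply: eq_bigr => i _; rewrite NegzE abszN mulrNz mulrN sinN opprK.
Qed.

Definition ang (a b : R) (x : int * int) : R := a * x.1%:~R + b * x.2%:~R.

Lemma angB a b x y : ang a b (x - y) = ang a b x - ang a b y.
Proof. by rewrite /ang /= !rmorphB /=; ring. Qed.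

Lemma angD a b x y : ang a b (x + y) = ang a b x + ang a b y.
Proof. by rewrite /ang /= !rmorphD /=; ring. Qed.

Definition gridpt k (i : 'I_(4 * k + 3).+1 * 'I_(4 * k + 3).+1) : R * R :=
  (grid (4 * k + 3).+1 i.1, grid (4 * k + 3).+1 i.2).
Arguments gridpt : clear implicits.

Lemma boxpt_inj k : injective (boxpt k).
Proof.
move=> [i1 i2] [j1 j2] [] /= e1 e2; congr (_, _); apply: val_inj => /=; lia.
Qed.

(** Orthogonality of the characters of the torus in real form. Differences of box points have
    coordinates smaller than the side, so each one-dimensional sum vanishes unless its coordinate is
    [0]. *)
Lemma sum_cos_gridpt k x y :
  \sum_i cos (ang (gridpt k i).1 (gridpt k i).2 (boxpt k x - boxpt k y)) =
  (x == y)%:R * (4 * k + 4)%:R ^+ 2.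
Proof.
set d := boxpt k x - boxpt k y.
have d1 : (`|d.1| < (4 * k + 3).+1)%N.
  by case: x y @d => [x1 x2] [y1 y2] /=; have := ltn_ord x1; have := ltn_ord y1; lia.
have d2 : (`|d.2| < (4 * k + 3).+1)%N.
  by case: x y @d {d1} => [x1 x2] [y1 y2] /=; have := ltn_ord x2; have := ltn_ord y2; lia.
rewrite -(pair_bigA _ (fun i j =>
  cos (ang (grid _ (nat_of_ord i)) (grid _ (nat_of_ord j)) d))) /=.
under eq_bigr do under eq_bigr do rewrite /ang cosD.
under eq_bigr do
  rewrite sumrB -!mulr_sumr (sum_cos_grid d2) (sum_sin_grid d2) mulr0 subr0.
rewrite -mulr_suml (sum_cos_grid d1).
have -> : (x == y) = (d.1 == 0) && (d.2 == 0).
  rewrite -(inj_eq (@boxpt_inj k)) -subr_eq0 -/d; by case: (d).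
by rewrite -mulnb natrM -addnS; ring.
Qed.

End Trig.
Arguments gridpt {R} k i.

(** * Bloch waves *)

Section Bloch.
Variable R : realType.
Implicit Types (f g : int * int -> R) (w v : bool * bool -> R).

Definition flip1 (c : bool * bool) := (~~ c.1, c.2).
Definition flip2 (c : bool * bool) := (c.1, ~~ c.2).
Definition flip3 (c : bool * bool) := (~~ c.1, ~~ c.2).

Lemma flip1K : involutive flip1. Proof. by case=> [[] []]. Qed.
Lemma flip2K : involutive flip2. Proof. by case=> [[] []]. Qed.
Lemma flip3K : involutive flip3. Proof. by case=> [[] []]. Qed.

(** The Bloch matrix acting on vectors indexed by parity classes. A step and its opposite lead to
    the same class with conjugate phases, which add up to twice a cosine. *)
Definition floquet (a b : R) w v c : R :=
  2 * cos a * v (flip1 c) + 2 * cos b * v (flip2 c)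
  + 2 * cos (a - b) * v (flip3 c) + w c * v c.

Lemma cls_step x :
  [/\ cls (x + step1) = flip1 (cls x), cls (x - step1) = flip1 (cls x),
      cls (x + step2) = flip2 (cls x) & cls (x - step2) = flip2 (cls x)] /\
  cls (x + step3) = flip3 (cls x) /\ cls (x - step3) = flip3 (cls x).
Proof.
by rewrite /cls /flip1 /flip2 /flip3 /= !oddzD !oddzN /= !addbT !addbF.
Qed.

(** Bloch waves are kept real: the phases [0] and [pi / 2] or [- (pi / 2)] give the cosine and, up
    to sign, the sine part of the complex wave. *)
Definition bloch (a b ph : R) v x : R := v (cls x) * cos (ang a b x + ph).

Lemma hopw_bloch a b ph w v x :
  hopw (fun x => w (cls x)) (bloch a b ph v) x = bloch a b ph (floquet a b w v) x.
Proof.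
rewrite /hopw /hop /bloch; have [[-> -> -> ->] [-> ->]] := cls_step x.
have e (t : R) y : ang a b y = t ->
    cos (ang a b (x + y) + ph) + cos (ang a b (x - y) + ph) =
    2 * cos t * cos (ang a b x + ph).
  move=> <-; rewrite angD angB addrAC (addrAC _ (- _)); set u := _ + ph.
  by rewrite cosD cosB; ring.
rewrite -!mulrDr (e a step1) ?(e b step2) ?(e (a - b) step3) /floquet;
  first (by move: (ang a b x) => y; ring); rewrite /ang /=;
  by rewrite ?(mulr1, mulr0, addr0, add0r, mulrN).
Qed.

(** A real Fourier coefficient, at quasimomentum [p], of the restriction of [f] to the class [c]. *)
Definition coef k (p : R * R) ph f c : R :=
  box k (fun x => f x * bloch p.1 p.2 ph (fun d => (d == c)%:R) x).

Lemma boxper_cls k w : boxper k (fun x => w (cls x)).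
Proof.
have e (n : int) : oddz (n + (4 * k + 4)%:Z) = oddz n by rewrite /oddz; lia.
by split=> x; rewrite /cls /= e addr0.
Qed.

Lemma grid_period k (i : nat) :
  grid R (4 * k + 3).+1 i * ((4 * k + 4)%:Z)%:~R = (pi *+ 2) *~ i%:Z.
Proof.
by rewrite /grid -!pmulrn -addnS divfK ?mulr_natr // pnatr_eq0 addnS.
Qed.

Lemma boxper_bloch k i ph v :
  boxper k (bloch (gridpt k i).1 (gridpt k i).2 ph v).
Proof.
have [h1 h2] := boxper_cls k v.
split=> x; rewrite /bloch ?h1 ?h2; congr (_ * _);
  rewrite angD addrAC {2}/ang /= rmorph0 mulr0 ?(addr0, add0r) /= grid_period;
  exact: cosDint.
Qed.

(** By symmetry the operator moves onto the Bloch wave, where [hopw_bloch] applies; the flips, being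
    involutions, then move from the summation class to [c]. *)
Lemma coef_hopw k i ph w f c : boxper k f ->
  coef k (gridpt k i) ph (hopw (fun x => w (cls x)) f) c =
  floquet (gridpt k i).1 (gridpt k i).2 w (coef k (gridpt k i) ph f) c.
Proof.
move=> fP; rewrite /coef hopw_sym //; last exact: boxper_bloch.
under eq_fun do rewrite hopw_bloch.
rewrite /floquet -!boxZ -!boxD; apply: eq_bigr => x _.
rewrite /bloch; set y := cls _; set C := cos (ang _ _ _ + _).
have -> : (flip1 y == c) = (y == flip1 c) by rewrite -(inv_eq flip1K).
have -> : (flip2 y == c) = (y == flip2 c) by rewrite -(inv_eq flip2K).
have -> : (flip3 y == c) = (y == flip3 c) by rewrite -(inv_eq flip3K).
have -> : w y * (y == c)%:R = w c * (y == c)%:R.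
  by have [->|_] := eqVneq y c; rewrite // !mulr0.
ring.
Qed.

(** Expanding the squares, the cosine and sine products combine into the cosine of a difference, and
    orthogonality keeps only the diagonal. *)
Lemma plancherel1 k f :
  \sum_i ((\sum_x f (boxpt k x) *
      cos (ang (gridpt k i).1 (gridpt k i).2 (boxpt k x) + 0)) ^+ 2
   + (\sum_x f (boxpt k x) *
      cos (ang (gridpt k i).1 (gridpt k i).2 (boxpt k x) + pi / 2)) ^+ 2)
  = (4 * k + 4)%:R ^+ 2 * box k (fun x => f x ^+ 2).
Proof.
transitivity (\sum_i \sum_x \sum_y f (boxpt k x) * f (boxpt k y) *
   cos (ang (gridpt k i).1 (gridpt k i).2 (boxpt k x - boxpt k y))).
  apply: eq_bigr => i _; rewrite !expr2 !mulr_suml -big_split; apply: eq_bigr => x _ /=.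
  rewrite !mulr_sumr -big_split; apply: eq_bigr => y _ /=.
  by rewrite !addr0 !cosDpihalf angB cosB; ring.
rewrite exchange_big mulr_sumr; apply: eq_bigr => x _ /=.
rewrite exchange_big /= (bigD1 x) //= [X in _ + X]big1 ?addr0 => [|y yx].
  by rewrite -mulr_sumr sum_cos_gridpt eqxx mul1r; ring.
by rewrite -mulr_sumr sum_cos_gridpt eq_sym (negPf yx) mul0r mulr0.
Qed.

(** [plancherel1] is applied to the restriction of [f] to each of the four classes; their supports
    are disjoint, so the squares add up. *)
Lemma plancherel k f :
  \sum_i \sum_c (coef k (gridpt k i) 0 f c ^+ 2 + coef k (gridpt k i) (pi / 2) f c ^+ 2)
  = (4 * k + 4)%:R ^+ 2 * box k (fun x => f x ^+ 2).
Proof.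
rewrite exchange_big /=.
transitivity (\sum_c (4 * k + 4)%:R ^+ 2 *
    box k (fun x => (f x * (cls x == c)%:R) ^+ 2)).
  apply: eq_bigr => c _; rewrite -plancherel1; apply: eq_bigr => i _.
  by congr (_ ^+ 2 + _ ^+ 2); apply: eq_bigr => x _; rewrite /bloch mulrA.
rewrite -mulr_sumr exchange_big; congr (_ * _); apply: eq_bigr => x _ /=.
rewrite (bigD1 (cls (boxpt k x))) //= eqxx mulr1 big1 ?addr0 // => c.
by rewrite eq_sym => /negPf ->; rewrite mulr0 expr0n.
Qed.

Lemma grid_bound k (i : 'I_(4 * k + 3).+1) :
  0 <= grid R (4 * k + 3).+1 i <= pi *+ 2.
Proof.
have h : 0 <= (pi *+ 2 : R) by rewrite mulrn_wge0 // pi_ge0.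
apply/andP; split; first by rewrite divr_ge0 // mulr_ge0.
by rewrite ler_pdivrMr ?ltr0n // ler_wpM2l // ler_nat ltnW.
Qed.

(** A bound that is uniform over the Floquet matrices becomes, by Plancherel, a bound on every torus
    with the same constant. *)
Lemma hopw_lower k w f m : boxper k f ->
  (forall a b v, 0 <= a <= pi *+ 2 -> 0 <= b <= pi *+ 2 ->
     m * \sum_c v c ^+ 2 <= \sum_c floquet a b w v c ^+ 2) ->
  m * box k (fun x => f x ^+ 2) <=
  box k (fun x => hopw (fun x => w (cls x)) f x ^+ 2).
Proof.
move=> fP mP.
have N0 : 0 < (4 * k + 4)%:R ^+ 2 :> R by rewrite exprn_gt0 // ltr0n addnS.
rewrite -(ler_pM2l N0) mulrCA -!plancherel mulr_sumr; apply: ler_sum => i _.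
rewrite !big_split mulrDr /=.
under [X in _ <= X + _]eq_bigr do rewrite coef_hopw //.
under [X in _ <= _ + X]eq_bigr do rewrite coef_hopw //.
by apply: lerD; apply: mP; apply: grid_bound.
Qed.

End Bloch.

(** * A contraction on square-summable functions *)

Lemma ler_sum_inj (R : numDomainType) (I J : finType) (e : I -> J) (F : J -> R) :
  injective e -> (forall j, 0 <= F j) -> \sum_i F (e i) <= \sum_j F j.
Proof.
move=> e_inj F0; rewrite -(big_imset _ (in2W e_inj)) /=.
rewrite [leRHS](bigID (mem [set e x | x : I])) /= lerDl sumr_ge0 //.
Qed.

Section Contraction.
Variable R : realType.
Implicit Types (f g h : int * int -> R) (w : bool * bool -> R).

Lemma le_box k f g : (forall x, f x <= g x) -> box k f <= box k g.
Proof. by move=> fg; apply: ler_sum. Qed.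

Lemma box_ge0 k f : (forall x, 0 <= f x) -> 0 <= box k f.
Proof. by move=> f0; apply: sumr_ge0. Qed.

(** The box with a margin of width [d] removed on each side; [d = 0] gives exactly the points
    [boxpt k i]. *)
Definition inbox k d (x : int * int) : bool :=
  [&& d%:Z - (2 * k + 2)%:Z <= x.1, x.1 < (2 * k + 2)%:Z - d%:Z,
      d%:Z - (2 * k + 2)%:Z <= x.2 & x.2 < (2 * k + 2)%:Z - d%:Z].

(** Representative in the box modulo its side; composing [f] with it periodizes the restriction of
    [f] to the box. *)
Definition bred k (x : int * int) : int * int :=
  (modz (x.1 + (2 * k + 2)%:Z) (4 * k + 4)%:Z - (2 * k + 2)%:Z,
   modz (x.2 + (2 * k + 2)%:Z) (4 * k + 4)%:Z - (2 * k + 2)%:Z).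

Lemma bredE k x : inbox k 0 x -> bred k x = x.
Proof.
case: x => a b /and4P[/= a1 a2 b1 b2].
by rewrite /bred /= !modz_small ?addrK //; apply/andP; split; lia.
Qed.

Lemma boxper_bred k f : boxper k (fun x => f (bred k x)).
Proof.
have e (a : int) : modz (a + (4 * k + 4)%:Z + (2 * k + 2)%:Z) (4 * k + 4)%:Z =
    modz (a + (2 * k + 2)%:Z) (4 * k + 4)%:Z by rewrite addrAC modzDr.
by split=> -[a b]; rewrite /bred pairD /= addr0 e.
Qed.

Lemma hopw_local k d w f g :
  (forall x, inbox k d x -> f x = g x) ->
  forall x, inbox k d.+1 x ->
    hopw (fun x => w (cls x)) f x = hopw (fun x => w (cls x)) g x.
Proof.
move=> fg x /and4P[x1 x2 x3 x4]; rewrite /hopw /hop !fg //=;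
  by apply/and4P; split => /=; lia.
Qed.

Lemma inbox_boxpt k i : inbox k 0 (boxpt k i).
Proof.
by case: i => i j; have hi := ltn_ord i; have hj := ltn_ord j;
  apply/and4P; split => /=; lia.
Qed.

Lemma inbox_index k x : inbox k 0 x -> exists i, boxpt k i = x.
Proof.
case: x => a b /and4P[/= a1 a2 b1 b2].
have ha : (absz (a + (2 * k + 2)%:Z)%R < (4 * k + 3).+1)%N by lia.
have hb : (absz (b + (2 * k + 2)%:Z)%R < (4 * k + 3).+1)%N by lia.
by exists (Ordinal ha, Ordinal hb); congr (_, _) => /=; lia.
Qed.

(** Consecutive boxes differ by a margin of 2 on each side, which is the range of two successive
    applications of [hopw]. *)
Lemma le_boxS k f g : (forall x, 0 <= g x) ->
  (forall x, inbox k.+1 2 x -> f x = g x) -> box k f <= box k.+1 g.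
Proof.
move=> g0 fg.
have lt4 (i : 'I_(4 * k + 3).+1) : (i + 2 < (4 * k.+1 + 3).+1)%N.
  by have := ltn_ord i; lia.
pose e (i : 'I_(4 * k + 3).+1 * 'I_(4 * k + 3).+1) :=
  (Ordinal (lt4 i.1), Ordinal (lt4 i.2)).
have eE i : boxpt k i = boxpt k.+1 (e i) by congr (_, _) => /=; lia.
have e_inj : injective e by move=> i j eij; apply: (@boxpt_inj k); rewrite !eE eij.
rewrite /box; under eq_bigr do rewrite eE.
apply: le_trans (ler_sum_inj (F := fun j => g (boxpt k.+1 j)) e_inj _); last by [].
apply: ler_sum => i _; rewrite fg // -eE.
by case: i => i j; have hi := ltn_ord i; have hj := ltn_ord j;
  apply/and4P; split => /=; lia.
Qed.

(** Cauchy-Schwarz: the difference of the two sides is the sum of the squared pairwise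
    differences. *)
Lemma sqr_sum7 (a b c d e f g : R) : (a + b + (c + d) + (e + f) + g) ^+ 2 <=
  7 * (a ^+ 2 + b ^+ 2 + (c ^+ 2 + d ^+ 2) + (e ^+ 2 + f ^+ 2) + g ^+ 2).
Proof.
rewrite -subr_ge0.
have := sqr_ge0 (a - b); have := sqr_ge0 (a - c); have := sqr_ge0 (a - d).
have := sqr_ge0 (a - e); have := sqr_ge0 (a - f); have := sqr_ge0 (a - g).
have := sqr_ge0 (b - c); have := sqr_ge0 (b - d); have := sqr_ge0 (b - e).
have := sqr_ge0 (b - f); have := sqr_ge0 (b - g); have := sqr_ge0 (c - d).
have := sqr_ge0 (c - e); have := sqr_ge0 (c - f); have := sqr_ge0 (c - g).
have := sqr_ge0 (d - e); have := sqr_ge0 (d - f); have := sqr_ge0 (d - g).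
have := sqr_ge0 (e - f); have := sqr_ge0 (e - g); have := sqr_ge0 (f - g).
lra.
Qed.

Variable w : bool * bool -> R.
Let D := hopw (fun x => w (cls x)).

Definition opbound : R := 7 * (6 + \sum_c w c ^+ 2).

Lemma opbound_gt0 : 0 < opbound.
Proof. by rewrite mulr_gt0 // ltr_wpDr // sumr_ge0 // => c _; apply: sqr_ge0. Qed.

Lemma hopw_upper k f : boxper k f ->
  box k (fun x => D f x ^+ 2) <= opbound * box k (fun x => f x ^+ 2).
Proof.
move=> fP.
have wb x : w x ^+ 2 <= \sum_c w c ^+ 2.
  by rewrite (bigD1 x) //= lerDl sumr_ge0 // => c _; apply: sqr_ge0.
have f2P : boxper k (fun x => f x ^+ 2) by case: fP => h1 h2; split=> x; rewrite ?h1 ?h2.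
apply: (@le_trans _ _ (box k (fun x => 7 *
    (f (x + step1) ^+ 2 + f (x - step1) ^+ 2 + (f (x + step2) ^+ 2 + f (x - step2) ^+ 2)
     + (f (x + step3) ^+ 2 + f (x - step3) ^+ 2) + (w (cls x) * f x) ^+ 2)))).
  by apply: le_box => x; apply: sqr_sum7.
rewrite boxZ -mulrA; apply: ler_wpM2l => //; rewrite !boxD mulrDl.
have sh s : (forall h, boxper k h -> box k (fun x => h (x + s)) = box k h) ->
    box k (fun x => f (x + s) ^+ 2) = box k (fun x => f x ^+ 2) /\
    box k (fun x => f (x - s) ^+ 2) = box k (fun x => f x ^+ 2).
  move=> sP; split; first by rewrite (sP (fun x => f x ^+ 2)).
  rewrite -(sP _ (boxper_shift (- s) f2P)).
  by apply: eq_bigr => i _; rewrite addrK.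
have [-> ->] := sh _ (@box_step1 _ k).
have [-> ->] := sh _ (@box_step2 _ k).
have [-> ->] := sh _ (@box_step3 _ k).
apply: lerD; first lra.
rewrite -boxZ; apply: le_box => x; rewrite exprMn ler_wpM2r ?sqr_ge0 //.
Qed.

Variables (eta m : R).
Hypothesis m_gt0 : 0 < m.
Hypothesis lower : forall k f, boxper k f ->
  m * box k (fun x => f x ^+ 2) <=
  box k (fun x => D f x ^+ 2) + eta ^+ 2 * box k (fun x => f x ^+ 2).

Definition normalop f x : R := D (D f) x + eta ^+ 2 * f x.

(** [opbound] bounds the square of [D] in norm; the factor 2 comes from the square of the two-term
    sum in [normalop]. *)
Let L := 2 * (opbound + eta ^+ 2).

Lemma L_gt0 : 0 < L.
Proof. by rewrite mulr_gt0 // ltr_wpDr ?sqr_ge0 ?opbound_gt0. Qed.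

Definition richardson f x : R := f x - L^-1 * normalop f x.

(** The contraction factor is [1 - m / L]; the maximum with [1/2] keeps it positive, as later
    divisions by the rate require. *)
Definition rate : R := Num.max (1 - m / L) 2^-1.

Lemma rate_gt0 : 0 < rate.
Proof. by rewrite lt_max; apply/orP; right; rewrite invr_gt0. Qed.

Lemma rate_lt1 : rate < 1.
Proof.
rewrite gt_max; apply/andP; split; last lra.
by rewrite ltrBlDr ltrDl divr_gt0 // L_gt0.
Qed.

(* Richardson iteration: with [s = <f, A f>] and [|A f|^2 <= L s], the squared
   norm of [f - A f / L] is at most [|f|^2 - s / L]. *)
Lemma richardson_periodic k f : boxper k f ->
  box k (fun x => richardson f x ^+ 2) <= rate * box k (fun x => f x ^+ 2).
Proof.
move=> fP.
have DP : boxper k (D f) by apply: boxper_hopw => //; apply: boxper_cls.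
set F := box k (fun x => f x ^+ 2).
set G := box k (fun x => D f x ^+ 2).
have F0 : 0 <= F by apply: box_ge0 => x; apply: sqr_ge0.
have G0 : 0 <= G by apply: box_ge0 => x; apply: sqr_ge0.
set s := G + eta ^+ 2 * F.
have fA : box k (fun x => f x * normalop f x) = s.
  rewrite /normalop; under eq_fun do rewrite mulrDr.
  rewrite boxD -hopw_sym // -/D; congr (_ + _).
  by rewrite -boxZ; apply: eq_bigr => i _; ring.
have AA : box k (fun x => normalop f x ^+ 2) <= L * s.
  have h1 : box k (fun x => D (D f) x ^+ 2) <= opbound * G by apply: hopw_upper.
  apply: (@le_trans _ _ (2 * box k (fun x => D (D f) x ^+ 2) + 2 * (eta ^+ 2) ^+ 2 * F)).
    rewrite -!boxZ -boxD; apply: le_box => x; rewrite /normalop.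
    have := sqr_ge0 (D (D f) x - eta ^+ 2 * f x); lra.
  rewrite /L /s.
  have := mulr_ge0 (ltW opbound_gt0) (mulr_ge0 (sqr_ge0 eta) F0).
  have := mulr_ge0 (sqr_ge0 eta) G0.
  by move: (eta ^+ 2) => e; lra.
have -> : box k (fun x => richardson f x ^+ 2) =
    F + (- (2 * L^-1)) * s + L^-1 ^+ 2 * box k (fun x => normalop f x ^+ 2).
  rewrite -fA -!boxZ -!boxD; apply: eq_bigr => i _; rewrite /richardson; ring.
have mF : m * F <= s by apply: lower.
have L0 := L_gt0.
have h1 : L^-1 ^+ 2 * box k (fun x => normalop f x ^+ 2) <= L^-1 * s.
  by rewrite expr2 -mulrA ler_wpM2l ?invr_ge0 ?(ltW L0) // ler_pdivrMl.
have h2 : m / L * F <= L^-1 * s.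
  by rewrite mulrAC mulrC ler_wpM2l ?invr_ge0 ?(ltW L0).
have h3 : (1 - m / L) * F <= rate * F.
  by rewrite ler_wpM2r // le_max lexx.
lra.
Qed.

(** The squared norm is at most [M], stated through finite box sums so that all estimates stay in
    [R]. *)
Definition l2le f (M : R) := forall k, box k (fun x => f x ^+ 2) <= M.

(** [f] is replaced by its periodization over the next box. Both agree there, and [richardson] has
    range 2, so its values on the smaller box are unchanged and the torus estimate applies. *)
Lemma l2le_richardson f M : l2le f M -> l2le (richardson f) (rate * M).
Proof.
move=> fM k; pose g := fun x => f (bred k.+1 x).
have gP : boxper k.+1 g by apply: boxper_bred.
have g_f x : inbox k.+1 0 x -> f x = g x by move=> xk; rewrite /g bredE.
apply: (@le_trans _ _ (box k.+1 (fun x => richardson g x ^+ 2))).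
  apply: le_boxS => [x|x xk]; first exact: sqr_ge0.
  rewrite /richardson /normalop /D (hopw_local w (hopw_local w g_f)) // g_f //.
  by case/and4P: xk => x1 x2 x3 x4; apply/and4P; split; lia.
apply: le_trans (richardson_periodic gP) _.
rewrite ler_wpM2l ?(ltW rate_gt0) //; apply: le_trans (fM k.+1).
by apply: ler_sum => i _; rewrite /g bredE // inbox_boxpt.
Qed.

End Contraction.

(** * Neumann iteration *)

Section Neumann.
Variable R : realType.
Implicit Types (f g h : int * int -> R).

Lemma hopwD w f g : hopw w (fun x => f x + g x) = fun x => hopw w f x + hopw w g x.
Proof. by apply/funext => x; rewrite /hopw /hop; ring. Qed.

Lemma hopwZ w c f : hopw w (fun x => c * f x) = fun x => c * hopw w f x.
Proof. by apply/funext => x; rewrite /hopw /hop; ring. Qed.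

Lemma hopw_cvg w (u : nat -> int * int -> R) f :
  (forall x, u n x @[n --> \oo] --> f x) ->
  forall x, hopw w (u n) x @[n --> \oo] --> hopw w f x.
Proof.
move=> uf x; rewrite /hopw /hop; do !apply: cvgD; try exact: uf.
by apply: cvgMr; apply: uf.
Qed.

Lemma l2le_pt f M x : l2le f M -> f x ^+ 2 <= M.
Proof.
move=> fM; set k := maxn (absz x.1) (absz x.2).
have [|i <-] := @inbox_index k x; first by apply/and4P; split; rewrite /k; lia.
apply: le_trans (fM k).
by rewrite /box (bigD1 i) //= lerDl sumr_ge0 // => j _; apply: sqr_ge0.
Qed.

Lemma l2le_ge0 f M : l2le f M -> 0 <= M.
Proof. by move=> /(l2le_pt 0); apply: le_trans; apply: sqr_ge0. Qed.

Lemma l2leZ c f M : l2le f M -> l2le (fun x => c * f x) (c ^+ 2 * M).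
Proof.
move=> fM k; under eq_fun do rewrite exprMn.
by rewrite boxZ ler_wpM2l ?sqr_ge0.
Qed.

(** Young's inequality. The parameter [e] stays free because [neumann_bound] needs the factor of [M]
    close to 1. *)
Lemma l2leD e f g M N : 0 < e -> l2le f M -> l2le g N ->
  l2le (fun x => f x + g x) ((1 + e) * M + (1 + e^-1) * N).
Proof.
move=> e0 fM gN k.
apply: (@le_trans _ _ ((1 + e) * box k (fun x => f x ^+ 2) +
                       (1 + e^-1) * box k (fun x => g x ^+ 2))).
  rewrite -!boxZ -boxD; apply: le_box => x; rewrite -subr_ge0.
  suff -> : (1 + e) * f x ^+ 2 + (1 + e^-1) * g x ^+ 2 - (f x + g x) ^+ 2 =
            (e * f x - g x) ^+ 2 / e by rewrite divr_ge0 ?sqr_ge0 ?ltW.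
  by field; rewrite gt_eqF.
by apply: lerD; apply: ler_wpM2l => //; have := invr_gt0 e; lra.
Qed.

Lemma cvg_big_sum (I : Type) (r : seq I) (u : nat -> I -> R) (l : I -> R) :
  (forall i, u n i @[n --> \oo] --> l i) ->
  \sum_(i <- r) u n i @[n --> \oo] --> \sum_(i <- r) l i.
Proof.
move=> ul; elim: r => [|i r IH].
  by under eq_fun do rewrite big_nil; rewrite big_nil; apply: cvg_cst.
by under eq_fun do rewrite big_cons; rewrite big_cons; apply: cvgD.
Qed.

(** A form of Fatou's lemma: each box sum is finite, so it passes to the pointwise limit. *)
Lemma l2le_cvg (u : nat -> int * int -> R) f M :
  (forall x, u n x @[n --> \oo] --> f x) -> (forall n, l2le (u n) M) -> l2le f M.
Proof.
move=> uf uM k.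
have c : box k (fun x => u n x ^+ 2) @[n --> \oo] --> box k (fun x => f x ^+ 2).
  apply: cvg_big_sum => i; apply: (@cvg_comp _ _ _ (fun n => u n _) (fun y => y ^+ 2)).
    exact: uf.
  exact: exprn_continuous.
apply: (closed_cvg (fun y => y <= M) (@closed_le _ M) _ _ c).
by apply: nearW => n; apply: uM.
Qed.

Lemma l2le_hopw (w : bool * bool -> R) f M :
  l2le f M -> l2le (hopw (fun x => w (cls x)) f) (opbound w * M).
Proof.
set D := hopw _; move=> fM k; pose g := fun x => f (bred k.+1 x).
have gP : boxper k.+1 g by apply: boxper_bred.
have g_f x : inbox k.+1 0 x -> f x = g x by move=> xk; rewrite /g bredE.
apply: (@le_trans _ _ (box k.+1 (fun x => D g x ^+ 2))).
  apply: le_boxS => [x|x xk]; first exact: sqr_ge0.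
  rewrite /D (hopw_local w g_f) //.
  by case/and4P: xk => x1 x2 x3 x4; apply/and4P; split; lia.
apply: le_trans (hopw_upper _ gP) _.
rewrite ler_wpM2l ?(ltW (opbound_gt0 _)) //; apply: le_trans (fM k.+1).
by apply: ler_sum => i _; rewrite /g bredE // inbox_boxpt.
Qed.

(** * Neumann series for the inverse of the normal operator *)

Section Iteration.
Variables (w : bool * bool -> R) (eta m : R).
Let D := hopw (fun x => w (cls x)).
Hypothesis m_gt0 : 0 < m.
Hypothesis lower : forall k f, boxper k f ->
  m * box k (fun x => f x ^+ 2) <=
  box k (fun x => D f x ^+ 2) + eta ^+ 2 * box k (fun x => f x ^+ 2).
Let r := rate w eta m.
Let L := 2 * (opbound w + eta ^+ 2).
Let A := normalop w eta.
Let B := richardson w eta.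

(** Partial sums of the series of [B^i f / L], which formally sums to [A^-1 f] since
    [B = 1 - A / L]. *)
Fixpoint neumann n f : int * int -> R :=
  if n is n'.+1 then fun x => B (neumann n' f) x + L^-1 * f x else fun=> 0.

Lemma normalopD f g : A (fun x => f x + g x) = fun x => A f x + A g x.
Proof.
by apply/funext => x; rewrite /A /normalop !hopwD; ring.
Qed.

Lemma normalopZ c f : A (fun x => c * f x) = fun x => c * A f x.
Proof.
by apply/funext => x; rewrite /A /normalop !hopwZ; ring.
Qed.

Lemma richardsonD f g : B (fun x => f x + g x) = fun x => B f x + B g x.
Proof.
by apply/funext => x; rewrite /B /richardson -/A normalopD; ring.
Qed.

Lemma richardsonZ c f : B (fun x => c * f x) = fun x => c * B f x.
Proof.
by apply/funext => x; rewrite /B /richardson -/A normalopZ; ring.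
Qed.

Lemma hopw_richardson f : D (B f) = B (D f).
Proof.
rewrite /B /richardson; under eq_fun do rewrite -mulNr.
rewrite /D hopwD hopwZ; apply/funext => x.
by rewrite /normalop hopwD hopwZ; ring.
Qed.

Lemma neumannD n f g :
  neumann n (fun x => f x + g x) = fun x => neumann n f x + neumann n g x.
Proof.
elim: n => [|n IH] /=; first by apply/funext => x; rewrite addr0.
by rewrite IH richardsonD; apply/funext => x; ring.
Qed.

Lemma neumannZ n c f : neumann n (fun x => c * f x) = fun x => c * neumann n f x.
Proof.
elim: n => [|n IH] /=; first by apply/funext => x; rewrite mulr0.
by rewrite IH richardsonZ; apply/funext => x; ring.
Qed.

Lemma hopw_neumann n f : D (neumann n f) = neumann n (D f).
Proof.
elim: n => [|n IH] /=; first by apply/funext => x; rewrite /D /hopw /hop; ring.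
by rewrite /D hopwD hopwZ -/D hopw_richardson IH.
Qed.

(** The series telescopes, because [A f / L = f - B f]. *)
Lemma neumann_normalop n f :
  neumann n (A f) = fun x => f x - iter n B f x.
Proof.
elim: n => [|n IH] /=; first by apply/funext => x; rewrite subrr.
rewrite IH; under [X in B X]eq_fun do rewrite -mulN1r.
rewrite richardsonD richardsonZ; apply/funext => x.
by rewrite {1}/B /richardson -/A; ring.
Qed.

Lemma neumann_diff n f x :
  neumann n.+1 f x - neumann n f x = iter n B (fun x => L^-1 * f x) x.
Proof.
have e : forall n, neumann n.+1 f =
    fun x => neumann n f x + iter n B (fun x => L^-1 * f x) x.
  elim=> [|{}n IH].
    by apply/funext => y /=; rewrite -/(B _) /B /richardson /normalop /hopw /hop; ring.
  rewrite -[LHS]/(fun x => B (neumann n.+1 f) x + L^-1 * f x) {1}IH richardsonD.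
  by apply/funext => y /=; ring.
by rewrite e addrAC subrr add0r.
Qed.

Lemma r_gt0 : 0 < r. Proof. exact: rate_gt0. Qed.
Lemma r_lt1 : r < 1. Proof. exact: rate_lt1. Qed.

Lemma l2le_iter n f M : l2le f M -> l2le (iter n B f) (r ^+ n * M).
Proof.
move=> fM; elim: n => [|n IH] /=; first by rewrite mul1r.
by rewrite exprS -mulrA; apply: l2le_richardson.
Qed.

(** A value is bounded by the norm; [rate] contracts squared norms, hence the square roots. *)
Lemma iter_le n f M x : l2le f M ->
  `|iter n B f x| <= geometric (Num.sqrt M) (Num.sqrt r) n.
Proof.
move=> fM; rewrite /= -ler_sqr ?nnegrE ?mulr_ge0 ?exprn_ge0 ?sqrtr_ge0 //.
rewrite real_normK ?num_real // exprMn sqr_sqrtr ?(l2le_ge0 fM) // -exprM mulnC exprM.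
by rewrite sqr_sqrtr ?(ltW r_gt0) // mulrC; apply/l2le_pt/l2le_iter.
Qed.

Lemma sqrt_rate_lt1 : `|Num.sqrt r| < 1.
Proof. by rewrite ger0_norm ?sqrtr_ge0 // -sqrtr1 ltr_sqrt // r_lt1. Qed.

Lemma iter_cvg0 f M x : l2le f M -> iter n B f x @[n --> \oo] --> (0 : R).
Proof.
move=> fM; apply/norm_cvg0P.
apply: (squeeze_cvgr _ (cvg_cst 0) (cvg_geometric (Num.sqrt M) sqrt_rate_lt1)).
by apply: nearW => n; rewrite normr_ge0 (iter_le _ _ fM).
Qed.

Definition neumann_lim f x : R := lim (neumann n f x @[n --> \oo]).

(** The increments of the partial sums are iterates of [B] by [neumann_diff], hence dominated by a
    geometric series. *)
Lemma neumann_cvg f M : l2le f M ->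
  forall x, neumann n f x @[n --> \oo] --> neumann_lim f x.
Proof.
move=> fM x; suff : cvg (neumann n f x @[n --> \oo]) by [].
have := telescopeK (fun n => neumann n f x); rewrite /= => e.
have -> : (fun n => neumann n f x) = series (telescope (fun n => neumann n f x)).
  by rewrite e; apply/funext => n /=; rewrite subr0.
apply: normed_cvg.
apply: series_le_cvg
  (is_cvg_geometric_series (a := Num.sqrt (L^-1 ^+ 2 * M)) sqrt_rate_lt1).
- by move=> n; apply: normr_ge0.
- by move=> n; apply: geometric_ge0; apply: sqrtr_ge0.
- by move=> n; rewrite /telescope /= neumann_diff; apply/iter_le/l2leZ.
Qed.

Lemma neumann_lim_eq f M (v : nat -> R) l x : l2le f M ->
  (forall n, neumann n f x = v n) -> v @ \oo --> l -> neumann_lim f x = l.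
Proof.
move=> fM /funext fv; apply: cvg_unique => //.
by rewrite -fv; apply: neumann_cvg fM _.
Qed.

Lemma neumann_limD f g M N x : l2le f M -> l2le g N ->
  neumann_lim (fun x => f x + g x) x = neumann_lim f x + neumann_lim g x.
Proof.
move=> fM gN; apply: (neumann_lim_eq (l2leD ltr01 fM gN)).
  by move=> n; rewrite neumannD.
by apply: cvgD; [exact: neumann_cvg fM _|exact: neumann_cvg gN _].
Qed.

Lemma neumann_limZ c f M x : l2le f M ->
  neumann_lim (fun x => c * f x) x = c * neumann_lim f x.
Proof.
move=> fM; apply: (neumann_lim_eq (l2leZ c fM)).
  by move=> n; rewrite neumannZ.
by apply: cvgMr; exact: neumann_cvg fM _.
Qed.

Lemma hopw_neumann_lim f M x : l2le f M -> D (neumann_lim f) x = neumann_lim (D f) x.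
Proof.
move=> fM; apply/esym/(neumann_lim_eq (l2le_hopw w fM)).
  by move=> n; rewrite -hopw_neumann.
exact: hopw_cvg (neumann_cvg fM) _.
Qed.

Lemma neumann_lim_normalop f M x : l2le f M ->
  neumann_lim (A f) x = f x.
Proof.
move=> fM; have AM := l2leD ltr01 (l2le_hopw w (l2le_hopw w fM)) (l2leZ (eta ^+ 2) fM).
apply: (neumann_lim_eq AM) => [n|]; first by rewrite neumann_normalop.
rewrite -[X in _ --> X]subr0; apply: cvgB; first exact: cvg_cst.
exact: iter_cvg0 fM.
Qed.

(** With [e = (1 - r) / (2 r)] in [l2leD] one has [(1 + e) r = (1 + r) / 2]; this constant is then
    the fixed point of the recursion for the squared norms of the partial sums. *)
Definition neumann_bound : R :=
  (1 + ((1 - r) / (2 * r))^-1) * L^-1 ^+ 2 / ((1 - r) / 2).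

Lemma l2le_neumann_lim f M : l2le f M -> l2le (neumann_lim f) (neumann_bound * M).
Proof.
move=> fM; have r1 := r_lt1; have r0 := r_gt0.
have e0 : 0 < (1 - r) / (2 * r) by rewrite divr_gt0 //; lra.
have C0 : 0 <= neumann_bound.
  rewrite /neumann_bound mulr_ge0 ?mulr_ge0 ?sqr_ge0 ?addr_ge0 ?invr_ge0 ?(ltW e0) //;
    by [exact/ltW/L_gt0 | lra].
apply: (l2le_cvg (neumann_cvg fM)); elim=> [|n IH].
  by move=> k /=; rewrite expr0n /= /box big1 // mulr_ge0 ?(l2le_ge0 fM).
have := l2leD e0 (l2le_richardson m_gt0 lower IH) (l2leZ L^-1 fM).
congr (l2le _ _); rewrite -/r /neumann_bound.
have : 1 - r != 0 by rewrite gt_eqF //; lra.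
have : r != 0 by rewrite gt_eqF.
by move: L^-1 => l ? ?; field; do ?[apply/andP; split].
Qed.

End Iteration.

End Neumann.

(** * Square-summable complex functions *)

Section Esum.
Variable R : realType.
Implicit Types (f g h : int * int -> R).

Definition boxseq k : seq (int * int) := [seq boxpt k i | i <- enum predT].

Lemma inbox_absz k (x : int * int) :
  (maxn (absz x.1) (absz x.2) <= k)%N -> inbox k 0 x.
Proof. by rewrite geq_max => /andP[h1 h2]; apply/and4P; split; lia. Qed.

Lemma boxseq_uniq k : uniq (boxseq k).
Proof. by rewrite map_inj_uniq ?enum_uniq //; apply: boxpt_inj. Qed.

Lemma fsum_boxseq k f :
  (\sum_(x \in [set` boxseq k]) (f x)%:E)%E = (box k f)%:E.
Proof. by rewrite -fsbig_seq ?boxseq_uniq // big_map big_enum /= sumEFin. Qed.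

Lemma le_box_esum k f :
  ((box k f)%:E <= \esum_(x in [set: int * int]) (f x)%:E)%E.
Proof.
apply: esum_ge; exists [set` boxseq k]; last by rewrite fsum_boxseq.
by split => //; apply: finite_seq.
Qed.

(** Every finite set of lattice points lies in some box. *)
Lemma esum_le_box f M : (forall x, 0 <= f x) -> (forall k, box k f <= M) ->
  (\esum_(x in [set: int * int]) (f x)%:E <= M%:E)%E.
Proof.
move=> f0 fM; apply: ge_ereal_sup => _ [F [finF _] <-].
pose k := (\max_(x <- fset_set F) maxn (absz x.1) (absz x.2))%N.
apply: (@le_trans _ _ (\sum_(x \in [set` boxseq k]) (f x)%:E)%E); last first.
  by rewrite fsum_boxseq lee_fin.
apply: lee_fsum_nneg_subset => //; first exact: finite_seq.
- move=> x xF; rewrite inE /=.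
  have xk : (maxn (absz x.1) (absz x.2) <= k)%N.
    apply: (@leq_bigmax_seq _ _ _ (fun x : int * int => maxn (absz x.1) (absz x.2))) => //.
    by rewrite in_fset_set.
  have [|i ix] := @inbox_index k x; first exact: inbox_absz.
  by apply/mapP; exists i; rewrite ?mem_enum.
- by move=> x _; rewrite lee_fin.
Qed.

Lemma Cmod_sqr (z : Cplx R) : Cmod z ^+ 2 = complex.Re z ^+ 2 + complex.Im z ^+ 2.
Proof.
case: z => a b; rewrite /Cmod /= sqr_sqrtr // addr_ge0 ?sqr_ge0 //.
Qed.

Implicit Types (psi phi : int * int -> Cplx R).

Definition rep psi x : R := complex.Re (psi x).
Definition imp psi x : R := complex.Im (psi x).

Lemma sqnorm2_le psi M N : l2le (rep psi) M -> l2le (imp psi) N ->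
  (sqnorm2 psi <= (M + N)%:E)%E.
Proof.
move=> rM iN; apply: esum_le_box => [x|k]; first exact: sqr_ge0.
by under eq_fun do rewrite Cmod_sqr; rewrite boxD lerD.
Qed.

Lemma ell2_l2le psi : ell2 psi -> exists M, [/\ sqnorm2 psi = M%:E,
  l2le (rep psi) M & l2le (imp psi) M].
Proof.
move=> psi2; have s0 : (0 <= sqnorm2 psi)%E.
  by apply: esum_ge0 => x _; rewrite lee_fin sqr_ge0.
have sE : sqnorm2 psi = (fine (sqnorm2 psi))%:E by rewrite fineK // ge0_fin_numE.
exists (fine (sqnorm2 psi)); split => // k; rewrite -lee_fin -sE;
  apply: le_trans (le_box_esum k _); rewrite lee_fin; apply: le_box => x;
  by rewrite Cmod_sqr ?lerDl ?lerDr sqr_ge0.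
Qed.

Lemma l2le_ell2 psi M N : l2le (rep psi) M -> l2le (imp psi) N -> ell2 psi.
Proof. by move=> rM iN; apply: le_lt_trans (sqnorm2_le rM iN) (ltry _). Qed.

Definition chopw (w : bool * bool -> R) psi x : Cplx R :=
  (psi (x + step1) + psi (x - step1)) + (psi (x + step2) + psi (x - step2))
  + (psi (x + step3) + psi (x - step3)) + Cinj (w (cls x)) * psi x.

Lemma rep_chopw w psi : rep (chopw w psi) = hopw (fun x => w (cls x)) (rep psi).
Proof.
apply/funext => x; rewrite /rep /chopw /hopw /hop /Cinj.
do 6!(case: (psi (x + _)) => ? ?); case: (psi x) => ? ?.
by rewrite /= mul0r subr0.
Qed.

Lemma imp_chopw w psi : imp (chopw w psi) = hopw (fun x => w (cls x)) (imp psi).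
Proof.
apply/funext => x; rewrite /imp /chopw /hopw /hop /Cinj.
do 6!(case: (psi (x + _)) => ? ?); case: (psi x) => ? ?.
by rewrite /= mul0r addr0.
Qed.

Lemma Cplx_eq psi phi : rep psi = rep phi -> imp psi = imp phi -> psi = phi.
Proof.
move=> e1 e2; apply/funext => x; move: (congr1 (@^~ x) e1) (congr1 (@^~ x) e2).
by rewrite /rep /imp; case: (psi x) => a b; case: (phi x) => c d /= -> ->.
Qed.

End Esum.

(** * Points of the resolvent set *)

Section Resolvent.
Variable R : realType.
Implicit Types (f g h : int * int -> R) (psi phi : int * int -> Cplx R).

(** The real part [E] of the spectral parameter is absorbed in the potential, while its imaginary
    part couples the real and imaginary parts of [psi]. *)
Lemma chopw_shift (w0 : bool * bool -> R) (E eta : R) psi :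
  rep (fun u => chopw w0 psi u - Complex E eta * psi u) =
    (fun x => hopw (fun x => w0 (cls x) - E) (rep psi) x + eta * imp psi x) /\
  imp (fun u => chopw w0 psi u - Complex E eta * psi u) =
    (fun x => hopw (fun x => w0 (cls x) - E) (imp psi) x + - eta * rep psi x).
Proof.
split; apply/funext => x.
  have := congr1 (@^~ x) (rep_chopw w0 psi); rewrite /= {1 3}/rep /imp.
  case: (chopw w0 psi x) => ? ? /= ->; rewrite /hopw /rep.
  by case: (psi x) => ? ? /=; ring.
have := congr1 (@^~ x) (imp_chopw w0 psi); rewrite /= {1 3}/imp /rep.
case: (chopw w0 psi x) => ? ? /= ->; rewrite /hopw /imp.
by case: (psi x) => ? ? /=; ring.
Qed.

Variables (w0 : bool * bool -> R) (E eta m : R).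
Let w c := w0 c - E.
Let D := hopw (fun x => w (cls x)).
Hypothesis m_gt0 : 0 < m.
Hypothesis lower : forall k f, boxper k f ->
  m * box k (fun x => f x ^+ 2) <=
  box k (fun x => D f x ^+ 2) + eta ^+ 2 * box k (fun x => f x ^+ 2).
Let U := neumann_lim w eta.

Let conj_re psi x : R := D (rep psi) x + - eta * imp psi x.
Let conj_im psi x : R := D (imp psi) x + eta * rep psi x.

(* With [A = D^2 + eta^2 = (T - z)^* (T - z)] and [U = A^-1], this is
   [U (T - z)^*] written out in real and imaginary parts. *)
Definition resolvent psi x : Cplx R := (U (conj_re psi) x +i* U (conj_im psi) x)%C.

Let cb : R := (1 + 1) * opbound w + (1 + 1^-1) * eta ^+ 2.

Lemma l2le_conj_re psi M :
  l2le (rep psi) M -> l2le (imp psi) M -> l2le (conj_re psi) (cb * M).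
Proof.
move=> rM iM; have := l2leD ltr01 (l2le_hopw w rM) (l2leZ (- eta) iM).
by congr (l2le _ _); rewrite /cb; ring.
Qed.

Lemma l2le_conj_im psi M :
  l2le (rep psi) M -> l2le (imp psi) M -> l2le (conj_im psi) (cb * M).
Proof.
move=> rM iM; have := l2leD ltr01 (l2le_hopw w iM) (l2leZ eta rM).
by congr (l2le _ _); rewrite /cb; ring.
Qed.

Lemma resolvent_bounded : bounded_operator resolvent.
Proof.
split=> [[a b] phi psi /ell2_l2le[M [_ rM iM]] /ell2_l2le[N [_ rN iN]]|].
  have e1 : rep (fun u => Complex a b * phi u + psi u) =
      fun x => a * rep phi x + - b * imp phi x + rep psi x.
    apply/funext => x; rewrite /rep /imp.
    by case: (phi x) => ? ?; case: (psi x) => ? ? /=; ring.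
  have e2 : imp (fun u => Complex a b * phi u + psi u) =
      fun x => a * imp phi x + b * rep phi x + imp psi x.
    apply/funext => x; rewrite /rep /imp.
    by case: (phi x) => ? ?; case: (psi x) => ? ? /=; ring.
  have l1 := l2le_conj_re rM iM; have l2 := l2le_conj_im rM iM.
  have l3 := l2le_conj_re rN iN; have l4 := l2le_conj_im rN iN.
  have e3 : conj_re (fun u => Complex a b * phi u + psi u) =
      fun x => a * conj_re phi x + - b * conj_im phi x + conj_re psi x.
    by rewrite /conj_re e1 e2 /conj_im /D !hopwD !hopwZ; apply/funext => x; ring.
  have e4 : conj_im (fun u => Complex a b * phi u + psi u) =
      fun x => a * conj_im phi x + b * conj_re phi x + conj_im psi x.
    by rewrite /conj_im e1 e2 /conj_re /D !hopwD !hopwZ; apply/funext => x; ring.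
  apply/funext => x; rewrite /resolvent e3 e4.
  rewrite /U (neumann_limD m_gt0 lower _ (l2leD ltr01 (l2leZ a l1) (l2leZ (- b) l2)) l3).
  rewrite (neumann_limD m_gt0 lower _ (l2leZ a l1) (l2leZ (- b) l2)).
  rewrite (neumann_limD m_gt0 lower _ (l2leD ltr01 (l2leZ a l2) (l2leZ b l1)) l4).
  rewrite (neumann_limD m_gt0 lower _ (l2leZ a l2) (l2leZ b l1)).
  rewrite !(neumann_limZ m_gt0 lower _ _ l1) !(neumann_limZ m_gt0 lower _ _ l2).
  by apply/eqP; rewrite eq_complex /=; apply/andP; split; apply/eqP; ring.
exists (neumann_bound w eta m * cb + neumann_bound w eta m * cb).
move=> psi /ell2_l2le[M [-> rM iM]].
rewrite -EFinM -[X in X%:E]/(_ * M).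
have -> : (neumann_bound w eta m * cb + neumann_bound w eta m * cb) * M =
  neumann_bound w eta m * (cb * M) + neumann_bound w eta m * (cb * M) by ring.
apply: sqnorm2_le.
  exact/(l2le_neumann_lim m_gt0 lower)/l2le_conj_re.
exact/(l2le_neumann_lim m_gt0 lower)/l2le_conj_im.
Qed.

(** In both orders of composition the terms linear in [eta] cancel and leave [U] applied to
    [normalop], which is the identity. The order with [resolvent] first also uses that [U] commutes
    with [D]. *)
Lemma resolventP : resolvent_set (chopw w0) (Complex E eta).
Proof.
exists resolvent; split; first exact: resolvent_bounded.
move=> psi /ell2_l2le[M [_ rM iM]].
have nE f : normalop w eta f = fun x => D (D f) x + eta ^+ 2 * f x by [].
split.
  have [e1 e2] := chopw_shift w0 E eta (resolvent psi).
  have l1 := l2le_conj_re rM iM; have l2 := l2le_conj_im rM iM.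
  apply: Cplx_eq; rewrite ?e1 ?e2; apply/funext => x.
    rewrite -[RHS](neumann_lim_normalop m_gt0 lower _ rM).
    rewrite -[rep (resolvent psi)]/(U (conj_re psi)) -[imp _]/(U (conj_im psi)).
    rewrite /U /D (hopw_neumann_lim m_gt0 lower _ l1).
    rewrite -(neumann_limZ m_gt0 lower _ _ l2).
    rewrite -(neumann_limD m_gt0 lower _ (l2le_hopw w l1) (l2leZ _ l2)).
    congr (neumann_lim _ _ _ _); apply/funext => y; rewrite nE /conj_re /conj_im.
    by rewrite /D hopwD hopwZ; ring.
  rewrite -[RHS](neumann_lim_normalop m_gt0 lower _ iM).
  rewrite -[rep (resolvent psi)]/(U (conj_re psi)) -[imp (resolvent _)]/(U (conj_im psi)).
  rewrite /U /D (hopw_neumann_lim m_gt0 lower _ l2).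
  rewrite -(neumann_limZ m_gt0 lower _ _ l1).
  rewrite -(neumann_limD m_gt0 lower _ (l2le_hopw w l2) (l2leZ _ l1)).
  congr (neumann_lim _ _ _ _); apply/funext => y; rewrite nE /conj_re /conj_im.
  by rewrite /D hopwD hopwZ; ring.
have [e1 e2] := chopw_shift w0 E eta psi.
apply: Cplx_eq; apply/funext => x.
  rewrite -[RHS](neumann_lim_normalop m_gt0 lower _ rM).
  rewrite {1}/rep /resolvent /= /U /conj_re e1 e2.
  congr (neumann_lim _ _ _ _); apply/funext => y; rewrite nE.
  by rewrite /D hopwD hopwZ; ring.
rewrite -[RHS](neumann_lim_normalop m_gt0 lower _ iM).
rewrite {1}/imp /resolvent /= /U /conj_im e1 e2.
congr (neumann_lim _ _ _ _); apply/funext => y; rewrite nE.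
by rewrite /D hopwD hopwZ; ring.
Qed.

End Resolvent.

(** * Points of the spectrum *)

Section Weyl.
Variable R : realType.
Implicit Types (f g : int * int -> R) (v : bool * bool -> R).

Lemma sum_geom_le (b : R) n : 0 <= b < 1 -> \sum_(0 <= i < n) b ^+ i <= (1 - b)^-1.
Proof.
move=> /andP[b0 b1]; rewrite big_mkord -[leRHS]mul1r ler_pdivlMr ?subr_gt0 // mulrC.
by have := subrX1 b n; have := exprn_ge0 n b0; lra.
Qed.

Lemma sum_abs_geom_le (b : R) K : 0 <= b < 1 ->
  \sum_(0 <= i < K + K) b ^+ absz (i%:Z - K%:Z)%R <= 2 / (1 - b).
Proof.
move=> b01; rewrite (@big_cat_nat _ _ _ K) ?leq_addr //= mulrDl !mul1r; apply: lerD.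
  rewrite big_nat_rev /=; apply: le_trans (sum_geom_le K b01).
  rewrite !big_nat; apply: ler_sum => i /= iK.
  rewrite (_ : absz _ = i.+1); last by lia.
  by case/andP: b01 => b0 b1; rewrite exprS ler_piMl ?exprn_ge0 // ltW.
rewrite -{1}(add0n K) big_addn addnK; apply: le_trans (sum_geom_le K b01).
by rewrite !big_nat; apply: ler_sum => i /= iK; rewrite (_ : absz _ = i) //; lia.
Qed.

Definition l1norm (x : int * int) : nat := (absz x.1 + absz x.2)%N.

(** The sum factors into two centred geometric sums. The bound is uniform in [k], so damped waves
    are square-summable. *)
Lemma box_geom_le (b : R) k : 0 <= b < 1 ->
  box k (fun x => b ^+ l1norm x) <= (2 / (1 - b)) ^+ 2.
Proof.
move=> b01; rewrite boxE.
under eq_bigr do under eq_bigr do rewrite exprD /boxpt /=.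
under eq_bigr do rewrite -mulr_sumr.
have e : \sum_(i < (4 * k + 3).+1) b ^+ absz (i%:Z - (2 * k + 2)%:Z)%R <= 2 / (1 - b).
  apply: le_trans (sum_abs_geom_le (2 * k + 2) b01).
  by rewrite (_ : (2 * k + 2 + _ = (4 * k + 3).+1)%N) ?big_mkord //; lia.
rewrite -mulr_suml expr2; case/andP: b01 => b0 b1.
by apply: ler_pM => //; apply: sumr_ge0 => i _; apply: exprn_ge0.
Qed.

(** * Damped Bloch waves *)

Section Weight.
Variable q : R.
Hypothesis q_bound : 2^-1 <= q < 1.

Definition weight (x : int * int) : R := q ^+ l1norm x.

Let q_gt0 : 0 < q. Proof. by have := q_bound; lra. Qed.

Lemma weight_gt0 x : 0 < weight x. Proof. exact: exprn_gt0. Qed.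

Lemma weight_step x s : (l1norm s <= 2)%N -> q ^+ 2 * weight x <= weight (x + s).
Proof.
move=> s2; have : (l1norm (x + s)%R <= 2 + l1norm x)%N.
  by move: s2; rewrite /l1norm /=; lia.
by move=> h; rewrite /weight -exprD ler_wiXn2l ?ltW // (andP q_bound).2.
Qed.

(** The ratio of the two weights lies between [q^2] and [q^-2], and [q^-2 - 1 <= 8 (1 - q)] for
    [q >= 1/2]. *)
Lemma weight_diff x s : (l1norm s <= 2)%N ->
  `|weight (x + s) - weight x| <= 8 * (1 - q) * weight x.
Proof.
move=> s2; have h1 := weight_step x s2.
have : q ^+ 2 * weight (x + s) <= weight x.
  rewrite -[in leRHS](addrK s x); apply: weight_step.
  by move: s2; rewrite /l1norm /= !abszN.
move=> h2; have w0 := weight_gt0 x; have w1 := weight_gt0 (x + s).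
move: (weight x) (weight (x + s)) h1 h2 w0 w1 => a b h1 h2 a0 b0.
have q2 : 0 < q ^+ 2 by exact: exprn_gt0.
have /andP[q_ge q_lt] := q_bound.
have e1 : 0 <= (1 - q) * (1 - q) * a by rewrite !mulr_ge0 // ?ltW //; lra.
have e2 : 0 <= (1 - q) * a by rewrite mulr_ge0 // ?ltW //; lra.
have e3 : 0 <= (q - 2^-1) * ((1 - q) * a) by rewrite mulr_ge0 //; lra.
have e4 : 0 <= (q - 2^-1) * (q - 2^-1) * ((1 - q) * a).
  by rewrite mulr_ge0 // -expr2 sqr_ge0.
rewrite ler_norml; apply/andP; split; first lra.
by rewrite -(ler_pM2l q2); lra.
Qed.

Variables (a b : R) (w v : bool * bool -> R).
Let D := hopw (fun x => w (cls x)).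
Hypothesis v_ker : forall c, floquet a b w v c = 0.

Definition packet ph x : R := weight x * bloch a b ph v x.

Let V := \sum_c `|v c|.

Lemma bloch_le ph x : `|bloch a b ph v x| <= V.
Proof.
rewrite /bloch normrM; apply: le_trans (ler_piMr _ (cos_max _)) _ => //.
by rewrite /V (bigD1 (cls x)) //= lerDl sumr_ge0.
Qed.

(** Since [D] kills the undamped wave, only differences of weights survive: six terms, each at most
    [8 V (1 - q)] times the weight. *)
Lemma packet_hopw ph x : `|D (packet ph) x| <= 48 * V * (1 - q) * weight x.
Proof.
have bx : D (bloch a b ph v) x = 0 by rewrite /D hopw_bloch /bloch v_ker mul0r.
pose d s := (weight (x + s) - weight x) * bloch a b ph v (x + s).
have -> : D (packet ph) x =
    d step1 + d (- step1) + (d step2 + d (- step2)) + (d step3 + d (- step3)).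
  have -> : D (packet ph) x = D (packet ph) x - weight x * D (bloch a b ph v) x.
    by rewrite bx; ring.
  by rewrite /D /hopw /hop /d /packet; ring.
have dE s : (l1norm s <= 2)%N -> `|d s| <= 8 * (1 - q) * weight x * V.
  move=> s2; rewrite normrM; apply: ler_pM => //; first exact: weight_diff.
  exact: bloch_le.
have := ler_normD (d step1 + d (- step1) + (d step2 + d (- step2)))
  (d step3 + d (- step3)).
have := dE step1 isT; have := dE (- step1) isT; have := dE step2 isT.
have := dE (- step2) isT; have := dE step3 isT; have := dE (- step3) isT.
have := ler_normD (d step1) (d (- step1)); have := ler_normD (d step2) (d (- step2)).
have := ler_normD (d step3) (d (- step3)).
have := ler_normD (d step1 + d (- step1)) (d step2 + d (- step2)).
lra.
Qed.

End Weight.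
Lemma box_shift_le g s M k : (forall x, 0 <= g x) ->
  (\esum_(x in [set: int * int]) (g x)%:E <= M%:E)%E ->
  box k (fun x => g (x + s)) <= M.
Proof.
move=> g0 gM; rewrite -lee_fin; apply: le_trans gM.
rewrite (@reindex_esum R _ _ setT setT (fun x => x + s)) //.
  exact: le_box_esum.
rewrite setTT_bijective; exists (fun x => x - s) => x; first exact: addrK.
exact: subrK.
Qed.

Lemma cls_cover x c : exists2 s, s \in [:: (0, 0); (1, 0); (0, 1); (1, 1) : int * int] &
  cls (x + s) = c.
Proof.
have e s : cls (x + s) = (oddz x.1 (+) oddz s.1, oddz x.2 (+) oddz s.2).
  by rewrite /cls /= !oddzD.
case: c => c1 c2.
exists (((oddz x.1 (+) c1 : bool) : nat)%:Z, ((oddz x.2 (+) c2 : bool) : nat)%:Z).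
  by case: (oddz x.1); case: (oddz x.2); case: c1; case: c2.
by rewrite e; case: (oddz x.1); case: (oddz x.2); case: c1; case: c2.
Qed.

(** A bounded inverse would bound the norm of the damped wave by that of its image under [T - E],
    which is of order [1 - q] relative to the norm of the weight; this fails for [q] near 1. *)
Lemma weyl (w0 : bool * bool -> R) (E a b : R) v c0 : v c0 != 0 ->
  (forall c, floquet a b (fun d => w0 d - E) v c = 0) ->
  ~ resolvent_set (chopw w0) (Complex E 0).
Proof.
move=> vc0 v_ker [S [[_ [M SM]] Sinv]].
pose V := \sum_c `|v c|.
have V0 : 0 <= V by apply: sumr_ge0.
(* Chosen so that the estimates [NM] and [XN] combine to [Xs <= K p^2 Xs]; [p = 1 / (2 + K)] ensures
   both [q >= 1/2] and [K p < 1]. The maximum with [0] covers a negative [M]. *)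
pose K := 64 * Num.max M 0 * (2 * (48 * V) ^+ 2) / v c0 ^+ 2.
have v2 : 0 < v c0 ^+ 2 by rewrite exprn_even_gt0.
have M0 : 0 <= Num.max M 0 by rewrite le_max lexx orbT.
have K0 : 0 <= K by rewrite divr_ge0 ?(ltW v2) // !mulr_ge0 ?sqr_ge0 //.
pose p : R := (2 + K)^-1.
have p0 : 0 < p by rewrite invr_gt0; lra.
have p1 : p <= 2^-1 by rewrite lef_pV2 ?posrE; lra.
have pK : K * p < 1 by rewrite ltr_pdivrMr; lra.
pose q := 1 - p.
have qb : 2^-1 <= q < 1 by rewrite /q; lra.
(* The two phases give cosine and sine, so the modulus of [psi] does not depend on the angle. *)
pose psi x : Cplx R := Complex (packet q a b v 0 x) (packet q a b v (- (pi / 2)) x).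
pose X := fun x => weight q x ^+ 2.
have psi2 x : Cmod (psi x) ^+ 2 = X x * v (cls x) ^+ 2.
  rewrite Cmod_sqr /= /packet /bloch addr0 cosBpihalf.
  have := cos2Dsin2 (ang a b x); set C := cos _; set C' := sin _ => e.
  rewrite -[RHS]mulr1 -e /X; ring.
have b0 : 0 <= q ^+ 2 < 1.
  by rewrite sqr_ge0 /= exprn_ilt1 //; lra.
have XB k : box k X <= (2 / (1 - q ^+ 2)) ^+ 2.
  apply: le_trans (box_geom_le k b0).
  by apply: ler_sum => i _; rewrite /X /weight -!exprM mulnC.
have [Xs [XsE Xk]] : exists Xs, (\esum_(x in [set: int * int]) (X x)%:E)%E = Xs%:E /\
    forall k, box k X <= Xs.
  have e0 : (0 <= \esum_(x in [set: int * int]) (X x)%:E)%E.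
    by apply: esum_ge0 => x _; rewrite lee_fin sqr_ge0.
  have e1 : (\esum_(x in [set: int * int]) (X x)%:E <= ((2 / (1 - q ^+ 2)) ^+ 2)%:E)%E.
    by apply: esum_le_box XB => x; apply: sqr_ge0.
  exists (fine (\esum_(x in [set: int * int]) (X x)%:E)%E).
  have eE : (\esum_(x in [set: int * int]) (X x)%:E)%E =
      (fine (\esum_(x in [set: int * int]) (X x)%:E)%E)%:E.
    by rewrite fineK // ge0_fin_numE // (le_lt_trans e1) ?ltry.
  by split => // k; rewrite -lee_fin -eE; apply: le_box_esum.
have Xs1 : 1 <= Xs.
  have := l2le_pt 0 (f := weight q) Xk; by rewrite /weight expr0 expr1n.
have pack2 ph : l2le (packet q a b v ph) (V ^+ 2 * Xs).
  move=> k; apply: (@le_trans _ _ (box k (fun x => V ^+ 2 * X x))); last first.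
    by rewrite boxZ ler_wpM2l ?sqr_ge0.
  apply: le_box => x; rewrite /packet exprMn mulrC /X ler_wpM2r ?sqr_ge0 //.
  by rewrite -[leLHS]real_normK ?num_real // ler_pXn2r ?nnegrE // bloch_le.
have Tpack2 ph : l2le (hopw (fun x => w0 (cls x) - E) (packet q a b v ph))
    ((48 * V * p) ^+ 2 * Xs).
  move=> k; apply: (@le_trans _ _ (box k (fun x => (48 * V * p) ^+ 2 * X x))); last first.
    by rewrite boxZ ler_wpM2l ?sqr_ge0.
  apply: le_box => x; rewrite -[leLHS]real_normK ?num_real // /X -exprMn.
  have pE : p = 1 - q by rewrite /q; lra.
  have h := packet_hopw qb v_ker ph x; rewrite -pE in h.
  by rewrite ler_pXn2r ?nnegrE ?h // (le_trans _ h).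
have rP : rep psi = packet q a b v 0 by apply/funext.
have iP : imp psi = packet q a b v (- (pi / 2)) by apply/funext.
have psi_l2 : ell2 psi.
  by apply: (@l2le_ell2 _ _ (V ^+ 2 * Xs) (V ^+ 2 * Xs)); rewrite ?rP ?iP; apply: pack2.
have [N [NE _ _]] := ell2_l2le psi_l2.
have NM : N <= Num.max M 0 * (2 * ((48 * V * p) ^+ 2 * Xs)).
  pose phi u := chopw w0 psi u - Complex E 0 * psi u.
  have [r1 r2] := chopw_shift w0 E 0 psi.
  have l1 : l2le (rep phi) ((48 * V * p) ^+ 2 * Xs).
    rewrite r1 rP; under eq_fun do rewrite mul0r addr0; exact: Tpack2.
  have l2 : l2le (imp phi) ((48 * V * p) ^+ 2 * Xs).
    rewrite r2 iP; under eq_fun do rewrite oppr0 mul0r addr0; exact: Tpack2.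
  have phi_l2 := l2le_ell2 l1 l2.
  have [N' [N'E r3 r4]] := ell2_l2le phi_l2.
  have := SM _ phi_l2; rewrite (Sinv _ psi_l2).2 NE.
  have := sqnorm2_le l1 l2; rewrite N'E -EFinM !lee_fin => h1 h2.
  apply: (le_trans h2); apply: (@le_trans _ _ (Num.max M 0 * N')).
    by rewrite ler_wpM2r ?(l2le_ge0 r3) // le_max lexx.
  by rewrite ler_wpM2l //; lra.
(* Among four shifts of [x] one reaches the class [c0]. Such a shift divides the squared weight by
   at most 16, whence [64 = 4 * 16]. *)
have XN : Xs <= 64 * N / v c0 ^+ 2.
  rewrite -lee_fin -XsE; apply: esum_le_box => [x|k]; first exact: sqr_ge0.
  pose g x := Cmod (psi x) ^+ 2.
  have g0 x : 0 <= g x by exact: sqr_ge0.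
  have gN : (\esum_(x in [set: int * int]) (g x)%:E <= N%:E)%E by rewrite -NE.
  have gk s := box_shift_le s k g0 gN.
  rewrite ler_pdivlMr // mulrC -boxZ.
  apply: (@le_trans _ _ (box k (fun x => 16 * (g (x + (0, 0)) + g (x + (1, 0)) +
      (g (x + (0, 1)) + g (x + (1, 1))))))); last first.
    rewrite boxZ !boxD; have := gk (0, 0); have := gk (1, 0).
    by have := gk (0, 1); have := gk (1, 1); lra.
  apply: le_box => x; have [s s_in cs] := cls_cover x c0.
  have gs : v c0 ^+ 2 * X x <= 16 * g (x + s).
    have s2 : (l1norm s <= 2)%N.
      by move: s_in; rewrite !inE => /or4P[] /eqP ->.
    have st := weight_step qb x s2; have wx := weight_gt0 qb x.
    have q4 : 4^-1 <= q ^+ 2 by nra.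
    have h : 4^-1 * weight q x <= weight q (x + s).
      by apply: le_trans st; rewrite ler_wpM2r // ltW.
    have h2 : X x <= 16 * X (x + s) by rewrite /X; nra.
    by rewrite /g psi2 cs mulrA mulrC ler_wpM2r // ltW.
  have g1 := g0 (x + (0, 0)); have g2 := g0 (x + (1, 0)).
  have g3 := g0 (x + (0, 1)); have g4 := g0 (x + (1, 1)).
  by move: s_in gs; rewrite !inE => /or4P[] /eqP ->; lra.
have : 1 * Xs <= K * p * Xs.
  rewrite mul1r; apply: (le_trans XN).
  have XsK : 64 * (Num.max M 0 * (2 * ((48 * V * p) ^+ 2 * Xs))) / v c0 ^+ 2 =
      p * (K * p * Xs) by rewrite /K; ring.
  apply: (@le_trans _ _ (p * (K * p * Xs))).
    by rewrite -XsK ler_wpM2r ?invr_ge0 ?(ltW v2) // ler_wpM2l.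
  rewrite ler_piMl //; last lra.
  exact: mulr_ge0 (mulr_ge0 K0 (ltW p0)) (le_trans ler01 Xs1).
rewrite ler_pM2r; lra.
Qed.

End Weyl.

(** * The Floquet matrix *)

Section Det.
Variable R : realType.

Definition mx4 (rows : seq (seq R)) : 'M[R]_4 :=
  \matrix_(i, j) nth 0 (nth [::] rows i) j.

Lemma det_floquet (A B C y z : R) :
  \det (mx4 [:: [:: z; A; B; C]; [:: A; y; C; B]; [:: B; C; y; A]; [:: C; B; A; y]]) =
  z * (y ^+ 3 - y * (A ^+ 2 + B ^+ 2 + C ^+ 2) + 2 * A * B * C)
  - y ^+ 2 * (A ^+ 2 + B ^+ 2 + C ^+ 2) + 6 * A * B * C * y
  + A ^+ 4 + B ^+ 4 + C ^+ 4
  - 2 * (A ^+ 2 * B ^+ 2 + B ^+ 2 * C ^+ 2 + C ^+ 2 * A ^+ 2).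
Proof.
rewrite (expand_det_row _ ord0) !big_ord_recl big_ord0 /cofactor.
rewrite !(expand_det_row _ ord0) !big_ord_recl !big_ord0 /cofactor.
rewrite !(expand_det_row _ ord0) !big_ord_recl !big_ord0 /cofactor.
rewrite !det_mx11 !mxE /=.
rewrite /bump /=.
ring.
Qed.

End Det.

(** * Kernel and quantitative invertibility of the Floquet matrix *)

Section Det.
Variable R : realType.

Lemma det_bound n (M : 'M[R]_n) (c : R) :
  (forall i j, `|M i j| <= c) -> `|\det M| <= n`!%:R * c ^+ n.
Proof.
move=> Mc; apply: (le_trans (ler_norm_sum _ _ _)).
apply: (@le_trans _ _ (\sum_(s : 'S_n) c ^+ n)).
  apply: ler_sum => s _; rewrite normrM normr_sign mul1r normr_prod.
  rewrite -[in leRHS](card_ord n) -prodr_const; apply: ler_prod => i _.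
  by rewrite normr_ge0 Mc.
by rewrite sumr_const mulr_natl -card_Sn lexx.
Qed.

Lemma sqr_sum4 (a b c d : R) :
  (a + (b + (c + d))) ^+ 2 <= 4 * (a ^+ 2 + (b ^+ 2 + (c ^+ 2 + d ^+ 2))).
Proof.
rewrite -subr_ge0.
have := sqr_ge0 (a - b); have := sqr_ge0 (a - c); have := sqr_ge0 (a - d).
have := sqr_ge0 (b - c); have := sqr_ge0 (b - d); have := sqr_ge0 (c - d); lra.
Qed.

(** From [adj M * M = det M], where the cofactors are at most [3! c^3] by the Leibniz formula.
    Cauchy-Schwarz and the sum over four coordinates give the remaining factor 4. *)
Lemma det4_lower (M : 'M[R]_4) (u : 'cV[R]_4) (c d : R) : 0 < c -> 0 < d ->
  (forall i j, `|M i j| <= c) -> d <= `|\det M| ->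
  (d / (24 * c ^+ 3)) ^+ 2 * \sum_i u i 0 ^+ 2 <= \sum_i (M *m u) i 0 ^+ 2.
Proof.
move=> c0 d0 Mc dM; set g := M *m u; set K := 6 * c ^+ 3.
have K0 : 0 < K by rewrite mulr_gt0 // exprn_gt0.
have adjE : \adj M *m g = \det M *: u by rewrite mulmxA mul_adj_mx mul_scalar_mx.
have adj_le i j : `|\adj M i j| <= K.
  rewrite mxE normrM normrX normrN1 expr1n mul1r.
  apply: (@det_bound 3) => i' j'; rewrite !mxE; exact: Mc.
have ui i : d ^+ 2 * u i 0 ^+ 2 <= 4 * K ^+ 2 * \sum_j g j 0 ^+ 2.
  apply: (@le_trans _ _ ((\det M * u i 0) ^+ 2)).
    rewrite exprMn ler_wpM2r ?sqr_ge0 // -[leRHS]real_normK ?num_real //.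
    by rewrite ler_pXn2r ?nnegrE // ltW.
  have -> : \det M * u i 0 = \sum_j \adj M i j * g j 0.
    by have := congr1 (fun X : 'cV_4 => X i 0) adjE; rewrite !mxE => <-.
  rewrite !big_ord_recl !big_ord0 !addr0; apply: le_trans (sqr_sum4 _ _ _ _) _.
  have h j : (\adj M i j * g j 0) ^+ 2 <= K ^+ 2 * g j 0 ^+ 2.
    rewrite exprMn ler_wpM2r ?sqr_ge0 // -[leLHS]real_normK ?num_real //.
    by rewrite ler_pXn2r ?nnegrE // ltW.
  rewrite -mulrA ler_wpM2l // !mulrDr; do !apply: lerD; exact: h.
have dK : (d / (24 * c ^+ 3)) ^+ 2 = d ^+ 2 / (16 * K ^+ 2).
  by rewrite /K; field; rewrite gt_eqF.
rewrite dK mulrAC ler_pdivrMr ?mulr_gt0 ?exprn_gt0 // mulr_sumr.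
apply: (@le_trans _ _ (\sum_(i < 4) (4 * K ^+ 2 * \sum_j g j 0 ^+ 2))).
  by apply: ler_sum => i _; apply: ui.
rewrite sumr_const card_ord -[_ *+ _]mulr_natl le_eqVlt.
by apply/orP; left; apply/eqP; ring.
Qed.

(** The class [c] sits at position [c.1 + 2 * c.2], the order of the rows of [floquet_mx]. *)
Definition vseq (v : bool * bool -> R) : seq R :=
  [:: v (false, false); v (true, false); v (false, true); v (true, true)].

Lemma sum_cls (F : bool * bool -> R) :
  \sum_c F c = \sum_(i < 4) nth 0 (vseq F) i.
Proof.
transitivity (\sum_x \sum_y F (x, y)).
  by rewrite pair_bigA; apply: eq_bigr => -[].
rewrite !big_bool /=.
by rewrite !big_ord_recl big_ord0 /=; ring.
Qed.

Variables (lam E : R).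

Definition potential (c : bool * bool) : R := - (lam * (c == (false, false))%:R).

Definition floquet_mx (a b : R) : 'M[R]_4 :=
  let A := 2 * cos a in let B := 2 * cos b in let C := 2 * cos (a - b) in
  mx4 [:: [:: - lam - E; A; B; C]; [:: A; - E; C; B];
          [:: B; C; - E; A]; [:: C; B; A; - E]].

Lemma floquet_mxE a b v :
  floquet_mx a b *m (\col_j nth 0 (vseq v) j) =
  \col_i nth 0 (vseq (floquet a b (fun c => potential c - E) v)) i.
Proof.
apply/matrixP => i j; rewrite !mxE !big_ord_recl big_ord0 !mxE /=.
case: i => -[|[|[|[|//]]]] hi /=;
  rewrite /floquet /potential /flip1 /flip2 /flip3 /=; ring.
Qed.

Definition charpoly (a b : R) : R := \det (floquet_mx a b).

Lemma floquet_kernel a b : charpoly a b = 0 ->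
  exists v c, v c != 0 /\ forall c, floquet a b (fun c => potential c - E) v c = 0.
Proof.
(* [det0P] yields a row vector in the left kernel, hence the transposition. *)
move=> /eqP; rewrite /charpoly -det_tr => /det0P[u u0 uM].
pose v (c : bool * bool) : R := u 0 (inord (c.1 + 2 * c.2)).
have vE : \col_j nth 0 (vseq v) j = u^T.
  apply/matrixP => i j; rewrite !mxE (ord1 j) /v.
  by case: i => -[|[|[|[|//]]]] hi /=; congr (u _ _); apply: val_inj; rewrite /= inordK.
exists v.
have [c vc] : exists c, v c != 0.
  apply/existsP; apply: contraNT u0; rewrite negb_exists => /forallP v0.
  apply/eqP; rewrite -[u]trmxK -vE; apply/matrixP => i j; rewrite !mxE.
  by case: j => -[|[|[|[|//]]]] hj /=; apply/eqP; rewrite -[_ == _]negbK v0.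
exists c; split => // {vc}c.
have : floquet_mx a b *m (\col_j nth 0 (vseq v) j) = 0.
  by rewrite vE -[LHS]trmxK trmx_mul trmxK uM trmx0.
rewrite floquet_mxE => /matrixP h.
case: c => -[] [].
- by have := h (inord 3) 0; rewrite !mxE inordK.
- by have := h (inord 1) 0; rewrite !mxE inordK.
- by have := h (inord 2) 0; rewrite !mxE inordK.
- by have := h (inord 0) 0; rewrite !mxE inordK.
Qed.

Lemma floquet_lower d a b v : 0 < d -> d <= `|charpoly a b| ->
  (d / (24 * (2 + `|lam| + `|E|) ^+ 3)) ^+ 2 * \sum_c v c ^+ 2 <=
  \sum_c floquet a b (fun c => potential c - E) v c ^+ 2.
Proof.
move=> d0 dp; set c := 2 + _ + _.
have l0 := normr_ge0 lam; have e0 := normr_ge0 E.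
have c0 : 0 < c by rewrite /c; lra.
have Mc i j : `|floquet_mx a b i j| <= c.
  have cs t : `|2 * cos t| <= c.
    by rewrite normrM ger0_norm //; have := cos_max t; rewrite /c; lra.
  have h1 : `|- E| <= c by rewrite normrN /c; lra.
  have h2 : `|- lam - E| <= c.
    by apply: le_trans (ler_normB _ _) _; rewrite normrN /c; lra.
  by rewrite mxE; case: i => -[|[|[|[|//]]]] hi; case: j => -[|[|[|[|//]]]] hj /=.
have := @det4_lower _ (\col_j nth 0 (vseq v) j) c d c0 d0 Mc dp.
rewrite floquet_mxE !sum_cls.
have e (u : bool * bool -> R) : \sum_i (\col_j nth 0 (vseq u) j : 'cV[R]_4) i 0 ^+ 2 =
    \sum_(i < 4) nth 0 (vseq (fun c => u c ^+ 2)) i.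
  by rewrite !big_ord_recl !big_ord0 !mxE.
by rewrite !e.
Qed.

End Det.

(** * The bands *)

Section Band.
Variable R : realType.

(* For [y = t + 2 = -E] this is [det (H + y)], where the three entries
   [X = 2 cos a], [Y = 2 cos b], [Z = 2 cos (a - b)] enter only through
   [n = 12 - X^2 - Y^2 - Z^2] and [p = (4 - X^2) (4 - Y^2) (4 - Z^2)]. *)
Definition bandpoly (lam t n p : R) : R :=
  t ^+ 2 * (t ^+ 2 + 8 * t + 2 * n) - p - lam * (t * (t ^+ 2 + 6 * t + n)).

Definition defect (a b : R) : R :=
  12 - (2 * cos a) ^+ 2 - (2 * cos b) ^+ 2 - (2 * cos (a - b)) ^+ 2.

Definition gapprod (a b : R) : R :=
  (4 - (2 * cos a) ^+ 2) * (4 - (2 * cos b) ^+ 2) * (4 - (2 * cos (a - b)) ^+ 2).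

Definition band (lam t a b : R) : R := bandpoly lam t (defect a b) (gapprod a b).

(** Obtained by squaring [sin a sin b], which is [cos (a - b) - cos a cos b]. It removes the product
    of the three entries from the determinant. *)
Lemma cos_relation (a b : R) :
  (2 * cos a) * (2 * cos b) * (2 * cos (a - b)) =
  (2 * cos a) ^+ 2 + (2 * cos b) ^+ 2 + (2 * cos (a - b)) ^+ 2 - 4.
Proof.
rewrite cosB; have := sin2cos2 a; have := sin2cos2 b.
move: (sin a) (sin b) (cos a) (cos b) => s s' c c' e' e.
have e2 : s ^+ 2 * s' ^+ 2 = (1 - c ^+ 2) * (1 - c' ^+ 2) by rewrite e e'.
have : 4 * (s ^+ 2 * s' ^+ 2 - (1 - c ^+ 2) * (1 - c' ^+ 2)) = 0 by rewrite e2; ring.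
lra.
Qed.

Lemma charpoly_band (lam t a b : R) : charpoly lam (- 2 - t) a b = band lam t a b.
Proof.
rewrite /charpoly /floquet_mx det_floquet /band /bandpoly /defect /gapprod.
have := cos_relation a b.
move: (2 * cos a) (2 * cos b) (2 * cos (a - b)) => A B C e.
apply/eqP; rewrite -subr_eq0; apply/eqP.
(* The determinant and [bandpoly] differ by this explicit multiple of the relation. *)
transitivity ((A * B * C - (A ^+ 2 + B ^+ 2 + C ^+ 2 - 4)) *
   (8 * (t + 2) - 2 * lam - A * B * C - (A ^+ 2 + B ^+ 2 + C ^+ 2 - 4))); first by ring.
by rewrite e subrr mul0r.
Qed.

Lemma gap_factor_ge0 (x : R) : 0 <= 4 - (2 * cos x) ^+ 2 <= 4.
Proof.
rewrite exprMn cos2sin2; have := sqr_ge0 (sin x); have := sqr_ge0 (cos x).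
rewrite cos2sin2; lra.
Qed.

Lemma defect_ge0 a b : 0 <= defect a b.
Proof.
rewrite /defect; have := gap_factor_ge0 a; have := gap_factor_ge0 b.
have := gap_factor_ge0 (a - b); lra.
Qed.

Lemma gapprod_ge0 a b : 0 <= gapprod a b.
Proof.
rewrite /gapprod; have /andP[? _] := gap_factor_ge0 a.
have /andP[? _] := gap_factor_ge0 b.
by have /andP[? _] := gap_factor_ge0 (a - b); rewrite !mulr_ge0.
Qed.

Lemma gapprod_le a b : gapprod a b <= 16 * defect a b.
Proof.
have /andP[] := gap_factor_ge0 a; have /andP[] := gap_factor_ge0 b.
have /andP[] := gap_factor_ge0 (a - b).
have -> : defect a b = (4 - (2 * cos a) ^+ 2) + (4 - (2 * cos b) ^+ 2)
   + (4 - (2 * cos (a - b)) ^+ 2) by rewrite /defect; ring.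
rewrite /gapprod; move: (4 - _) (4 - _) (4 - _) => x y z z0 z4 y0 y4 x0 x4.
have h1 : x * y <= 4 * 4 by apply: ler_pM.
have h2 : x * y * z <= 16 * z by rewrite ler_wpM2r //; lra.
lra.
Qed.

(** The parameters [t] for which [-2 - t] is an eigenvalue at some quasimomentum. *)
Definition bandset (lam : R) : set R := [set t | exists a b, band lam t a b = 0].

(** Replacing one factor [t] by [lam / 2] bounds the leading term, and
    [(t^2 + 8 t + 2 n) / 2 < t^2 + 6 t + n]. *)
Lemma bandpoly_gap lam t n p : 0 < t -> t <= lam / 2 -> 0 <= n -> 0 <= p ->
  bandpoly lam t n p < 0.
Proof.
move=> t0 tl n0 p0; rewrite /bandpoly.
have h1 : t * (t ^+ 2 + 8 * t + 2 * n) <= lam / 2 * (t ^+ 2 + 8 * t + 2 * n).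
  by rewrite ler_wpM2r // !addr_ge0 // ?sqr_ge0 // mulr_ge0 // ltW.
have l0 : 0 < lam by lra.
have h2 : lam / 2 * (t ^+ 2 + 8 * t + 2 * n) < lam * (t ^+ 2 + 6 * t + n).
  by rewrite -mulrA ltr_pM2l //; have := exprn_gt0 2 t0; lra.
have h3 : t * (t * (t ^+ 2 + 8 * t + 2 * n)) < t * (lam * (t ^+ 2 + 6 * t + n)).
  by rewrite ltr_pM2l // (le_lt_trans h1).
lra.
Qed.

(** Monotonicity of the quotient of [bandpoly] by [t (t^2 + 6 t + n)], cross-multiplied. The
    difference is [y - x] times a polynomial with only nonnegative terms. *)
Lemma bandpoly_cross lam x y n p : 0 < x -> x < y -> 0 <= n -> 0 <= p ->
  bandpoly lam x n p * (y * (y ^+ 2 + 6 * y + n)) <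
  bandpoly lam y n p * (x * (x ^+ 2 + 6 * x + n)).
Proof.
move=> x0 xy n0 p0; rewrite -subr_gt0 /bandpoly.
have y0 : 0 < y by apply: lt_trans xy.
have -> : (y ^+ 2 * (y ^+ 2 + 8 * y + 2 * n) - p - lam * (y * (y ^+ 2 + 6 * y + n)))
   * (x * (x ^+ 2 + 6 * x + n)) -
   (x ^+ 2 * (x ^+ 2 + 8 * x + 2 * n) - p - lam * (x * (x ^+ 2 + 6 * x + n)))
   * (y * (y ^+ 2 + 6 * y + n)) =
  (y - x) * (p * (x ^+ 2 + x * y + y ^+ 2 + 6 * (x + y) + n) +
    x * y * (x ^+ 2 * y ^+ 2 + 6 * (x * y * (x + y)) + n * ((y - x) ^+ 2 + x * y)
      + 48 * (x * y) + 8 * (n * (x + y)) + 2 * n ^+ 2)) by ring.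
rewrite mulr_gt0 ?subr_gt0 // ltr_wpDl ?mulr_gt0 //.
  by rewrite mulr_ge0 // !addr_ge0 // ?mulr_ge0 ?addr_ge0 ?sqr_ge0 // ltW.
rewrite ltr_wpDr ?mulr_ge0 ?sqr_ge0 //.
rewrite ltr_wpDr ?mulr_ge0 ?addr_ge0 ?(ltW x0) ?(ltW y0) //.
rewrite ltr_wpDl ?mulr_gt0 //.
by rewrite !addr_ge0 // ?mulr_ge0 ?addr_ge0 ?sqr_ge0 // ?mulr_ge0 // ltW.
Qed.

Lemma band_above lam x y a b : 0 < x -> x < y -> band lam x a b = 0 -> 0 < band lam y a b.
Proof.
move=> x0 xy e; have := bandpoly_cross lam x0 xy (defect_ge0 a b) (gapprod_ge0 a b).
rewrite -/(band lam x a b) e mul0r pmulr_lgt0 // mulr_gt0 // ltr_wpDr ?defect_ge0 //.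
by rewrite addr_gt0 ?exprn_gt0 ?mulr_gt0.
Qed.

Lemma band_below lam x y a b : 0 < x -> x < y -> band lam y a b = 0 -> band lam x a b < 0.
Proof.
move=> x0 xy e; have := bandpoly_cross lam x0 xy (defect_ge0 a b) (gapprod_ge0 a b).
have y0 := lt_trans x0 xy.
rewrite -/(band lam y a b) e mul0r pmulr_llt0 // mulr_gt0 // ltr_wpDr ?defect_ge0 //.
by rewrite addr_gt0 ?exprn_gt0 ?mulr_gt0.
Qed.

Lemma band_continuous lam t : continuous (fun p : R * R => band lam t p.1 p.2).
Proof.
have cc (f : R * R -> R) : continuous f -> continuous (fun p => 4 - (2 * cos (f p)) ^+ 2).
  move=> cf p; apply: cvgB; first exact: cvg_cst.
  have h : (2 * cos (f q)) @[q --> p] --> 2 * cos (f p).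
    apply: cvgMr; apply: (@cvg_comp _ _ _ f cos); [exact: cf|exact: continuous_cos].
  exact: (cvgM h h).
have c1 : continuous (fun p : R * R => 4 - (2 * cos p.1) ^+ 2).
  by apply: cc => p; exact: cvg_fst.
have c2 : continuous (fun p : R * R => 4 - (2 * cos p.2) ^+ 2).
  by apply: cc => p; exact: cvg_snd.
have c3 : continuous (fun p : R * R => 4 - (2 * cos (p.1 - p.2)) ^+ 2).
  by apply: cc => p; apply: cvgB; [exact: cvg_fst|exact: cvg_snd].
have -> : (fun p : R * R => band lam t p.1 p.2) = fun p : R * R =>
    (2 * t ^+ 2 - lam * t) * ((4 - (2 * cos p.1) ^+ 2) + (4 - (2 * cos p.2) ^+ 2)
      + (4 - (2 * cos (p.1 - p.2)) ^+ 2))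
    - (4 - (2 * cos p.1) ^+ 2) * (4 - (2 * cos p.2) ^+ 2)
      * (4 - (2 * cos (p.1 - p.2)) ^+ 2)
    + (t ^+ 2 * (t ^+ 2 + 8 * t) - lam * (t * (t ^+ 2 + 6 * t))).
  by apply/funext => p; rewrite /band /bandpoly /defect /gapprod; ring.
move=> p; apply: cvgD; last exact: cvg_cst.
apply: cvgB; last by apply: cvgM; [apply: cvgM; [exact: c1|exact: c2]|exact: c3].
by apply: cvgMr; apply: cvgD; [apply: cvgD; [exact: c1|exact: c2]|exact: c3].
Qed.

(** Intermediate values at fixed [t], along the segment joining the two quasimomenta. *)
Lemma bandset_ivt lam t a0 b0 a1 b1 :
  band lam t a0 b0 <= 0 -> 0 <= band lam t a1 b1 -> bandset lam t.
Proof.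
move=> h0 h1.
pose path (s : R) : R * R := (a0 + s * (a1 - a0), b0 + s * (b1 - b0)).
have cpath : continuous path.
  have aff (u v : R) : continuous (fun s : R => u + s * v).
    by move=> s; apply: cvgD; [exact: cvg_cst|apply: cvgMl; exact: cvg_id].
  by move=> s; exact: (cvg_pair (aff _ _ s) (aff _ _ s)).
have c : continuous (fun s => band lam t (path s).1 (path s).2).
  move=> s; apply: (@cvg_comp _ _ _ path (fun p => band lam t p.1 p.2)).
    exact: cpath.
  exact: band_continuous.
have c' : {within `[0, 1]%classic,
    continuous (fun s : R => band lam t (path s).1 (path s).2)}.
  exact: continuous_subspaceT.
have [|s _ e] := IVT (v := 0) ler01 c'.
- rewrite /path /= !mul0r !addr0 !mul1r !subrKC ge_min le_max h0 h1 /=.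
  by rewrite orbT.
by exists (path s).1, (path s).2.
Qed.

(** A continuous function without zeros is bounded away from zero on a compact period square. *)
Lemma band_lower_bound lam t : ~ bandset lam t ->
  exists2 d, 0 < d & forall a b, 0 <= a <= pi *+ 2 -> 0 <= b <= pi *+ 2 ->
    d <= `|band lam t a b|.
Proof.
move=> nt; pose A : set (R * R) := `[0, pi *+ 2]%classic `*` `[0, pi *+ 2]%classic.
have p0 : 0 <= (pi *+ 2 : R) by rewrite mulrn_wge0 // pi_ge0.
have A0 : A !=set0 by exists (0, 0); split => /=; rewrite in_itv /= lexx.
have cA : compact A by apply: compact_setX; exact: segment_compact.
have cf : continuous (fun p : R * R => `|band lam t p.1 p.2|).
  by move=> p; apply: cvg_norm; apply: band_continuous.
have [[a0 b0] _ amin] := compact_EVT_min A0 cA (continuous_subspaceT cf).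
exists `|band lam t a0 b0|.
  by rewrite normr_gt0; apply/eqP => e; apply: nt; exists a0, b0.
move=> a b ha hb; apply: (amin (a, b)); rewrite inE; split => /=; by rewrite in_itv.
Qed.

End Band.

(** * Intervals and gap in the set of energies *)

Section BandSet.
Variable R : realType.

(** The first of three test quasimomenta, with [n = p = 0]. The next two have [n = 9], [p = 27]
    (angles [2 pi / 3] and [- 2 pi / 3]) and [n = 8], [p = 0]. *)
Lemma band_center (lam t : R) :
  band lam t 0 0 = t ^+ 2 * (t ^+ 2 + 8 * t - lam * t - 6 * lam).
Proof. by rewrite /band /bandpoly /defect /gapprod subrr cos0; ring. Qed.

Lemma band_corner (lam t : R) : exists a b : R,
  band lam t a b = (t + 3) ^+ 2 * ((t - 1) * (t + 3) - lam * t).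
Proof.
exists (acos (- 2^-1)), (- acos (- 2^-1)).
have c : cos (acos (- 2^-1)) = - 2^-1 :> R by rewrite acosK // in_itv /=; lra.
rewrite /band /bandpoly /defect /gapprod opprK -mulr2n cos_mulr2n cosN c.
by field; lra.
Qed.

Lemma band_side (lam t : R) :
  band lam t (pi / 2) (pi / 2) = t * (t + 4) * (t * (t + 4) - lam * (t + 2)).
Proof. by rewrite /band /bandpoly /defect /gapprod subrr cos0 cos_pihalf; ring. Qed.

Variable lam : R.
Hypothesis lam01 : 0 < lam < 1.

Lemma bandset0 : bandset lam 0.
Proof. by exists 0, 0; rewrite band_center; ring. Qed.

Lemma bandset_gap t : 0 < t -> t <= lam / 2 -> ~ bandset lam t.
Proof.
move=> t0 tl [a [b e]].
have := bandpoly_gap t0 tl (defect_ge0 a b) (gapprod_ge0 a b).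
by rewrite -/(band _ _ _ _) e ltxx.
Qed.

(** By [p <= 16 n] the difference is at least [(2 t^2 - lam t - 16) n], which is nonnegative for
    [t <= -3]. *)
Lemma band_center_le t a b : t <= - 3 -> band lam t 0 0 <= band lam t a b.
Proof.
move=> t3; have [l0 l1] := andP lam01.
have n0 := defect_ge0 a b; have pn := gapprod_le a b.
rewrite band_center /band /bandpoly.
have h1 : 0 <= (- 3 - t) * (- t) * defect a b by rewrite !mulr_ge0 //; lra.
have h2 : 0 <= lam * - t * defect a b by rewrite !mulr_ge0 //; lra.
have h3 : 0 <= (- 3 - t) * defect a b by rewrite mulr_ge0 //; lra.
lra.
Qed.

(** For [s >= -3] the centre gives a nonpositive value and the side a nonnegative one. For [s < -3]
    the corner replaces the side, and the sign at the centre is inherited from [t]. *)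
Lemma bandset_upper t s : bandset lam t -> t <= s -> s <= 0 -> bandset lam s.
Proof.
move=> tB ts s0; have [l0 l1] := andP lam01.
have [s3|s3] := leP (- 3) s.
  apply: (@bandset_ivt _ _ _ 0 0 (pi / 2) (pi / 2)).
    rewrite band_center mulr_ge0_le0 ?sqr_ge0 //.
    have h1 : 0 <= - s * (s + 8) by rewrite mulr_ge0 //; lra.
    have h2 : 0 <= lam * (s + 6) by rewrite mulr_ge0 //; lra.
    lra.
  rewrite band_side; have h1 : 0 <= - s * (s + 4) by rewrite mulr_ge0 //; lra.
  have h2 : 0 <= lam * (s + 3) by rewrite mulr_ge0 //; lra.
  rewrite mulr_le0 //; first lra.
  have [s1|s1] := leP s (- 1).
    have h3 : 0 <= (- 1 - s) * (s + 3) by rewrite mulr_ge0 //; lra.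
    lra.
  have h3 : 0 <= lam * (s + 2) by rewrite mulr_ge0 //; lra.
  lra.
have [a [b e]] := band_corner lam s.
apply: (@bandset_ivt _ _ _ 0 0 a b); last first.
  have h1 : 0 <= (1 - s) * (- 3 - s) by rewrite mulr_ge0 //; lra.
  have h2 : 0 <= lam * - s by rewrite mulr_ge0 //; lra.
  by rewrite e mulr_ge0 ?sqr_ge0 //; lra.
(* At [t] the centre minimizes [band], which has a zero, so the value at the centre is
   nonpositive. *)
have tc : t ^+ 2 + 8 * t - lam * t - 6 * lam <= 0.
  have t3 : t <= - 3 by lra.
  case: tB => a' [b' e'].
  have := band_center_le a' b' t3; rewrite e' band_center pmulr_rle0 //.
  by rewrite exprn_even_gt0 //; apply/orP; right; lra.
rewrite band_center mulr_ge0_le0 ?sqr_ge0 //.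
have [s8|s8] := leP 0 (s + 8 - lam).
  have h1 : 0 <= - s * (s + 8 - lam) by rewrite mulr_ge0 //; lra.
  lra.
have : - s * - (s + 8 - lam) <= - t * - (t + 8 - lam) by rewrite ler_pM //; lra.
lra.
Qed.

(** By monotonicity in [t], the quasimomentum with a zero at [x] gives a positive value at [t], and
    the one with a zero at [y] a negative value. *)
Lemma bandset_lower x t y :
  0 < x -> bandset lam x -> bandset lam y -> x <= t -> t <= y -> bandset lam t.
Proof.
move=> x0 [a [b ex]] [a' [b' ey]].
rewrite le_eqVlt => /orP[/eqP <- _|xt]; first by exists a, b.
rewrite le_eqVlt => /orP[/eqP ->|ty]; first by exists a', b'.
apply: (@bandset_ivt _ _ _ a' b' a b).
  by apply/ltW/(band_below _ ty) => //; apply: lt_trans xt.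
exact/ltW/(band_above x0 xt).
Qed.

(** The second factor at the corner is [- lam] at [t = 1] and [5 - 2 lam] at [t = 2]. *)
Lemma bandset_pos : exists2 t, 0 < t & bandset lam t.
Proof.
have [l0 l1] := andP lam01.
pose F (t : R) := t ^+ 2 + (2 - lam) * t - 3.
have : {within `[1, 2]%classic, continuous F}.
  apply: continuous_subspaceT => t; apply: cvgB; last exact: cvg_cst.
  by apply: cvgD; [exact: exprn_continuous|apply: cvgMr; exact: cvg_id].
move=> /(IVT (v := 0) _)[|| t]; first lra.
  by rewrite ge_min le_max /F; apply/andP; split; apply/orP; [left|right]; lra.
rewrite in_itv /= => /andP[t1 t2] Ft; exists t; first lra.
have [a [b e]] := band_corner lam t; exists a, b; rewrite e.
have -> : (t - 1) * (t + 3) - lam * t = F t by rewrite /F; ring.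
by rewrite Ft mulr0.
Qed.

End BandSet.

(** * Coordinates on the triangular lattice *)

Section Transport.
Variables (R : realType) (V W : choiceType) (e : W -> V) (c : V -> W).
Hypotheses (eK : cancel e c) (cK : cancel c e).

Lemma sqnorm2_comp (psi : V -> Cplx R) : sqnorm2 (psi \o e) = sqnorm2 psi.
Proof.
rewrite /sqnorm2 [RHS](@reindex_esum R _ _ setT setT e) //.
by rewrite setTT_bijective; exists c.
Qed.

(** Relabelling the vertices is a unitary conjugation, which carries the inverse along. *)
Lemma resolvent_set_comp (T : (V -> Cplx R) -> V -> Cplx R)
    (T' : (W -> Cplx R) -> W -> Cplx R) :
  (forall psi w, T' (psi \o e) w = T psi (e w)) ->
  resolvent_set T `<=` resolvent_set T'.
Proof.
move=> TT' z [S [[Slin [M SM]] Sinv]].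
have comp_c (phi : W -> Cplx R) : (phi \o c) \o e = phi.
  by apply/funext => w /=; rewrite eK.
have sq_c (phi : W -> Cplx R) : sqnorm2 (phi \o c) = sqnorm2 phi.
  by rewrite -sqnorm2_comp comp_c.
have l2_c (phi : W -> Cplx R) : ell2 phi -> ell2 (phi \o c).
  by rewrite /ell2 /= sq_c.
exists (fun phi => S (phi \o c) \o e); split.
  split=> [a phi psi /l2_c phi2 /l2_c psi2|].
    by have := congr1 (fun f => f \o e) (Slin a _ _ phi2 psi2).
  by exists M => phi /l2_c phi2; rewrite sqnorm2_comp -[in leRHS]sq_c; apply: SM.
move=> phi phi2; have [h1 h2] := Sinv _ (l2_c _ phi2).
split; apply/funext => w.
  rewrite TT' /=; have := congr1 (fun f => f (e w)) h1; by rewrite /= eK.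
have := congr1 (fun f => f (e w)) h2; rewrite /= eK => <-.
congr (S _ _); apply/funext => v /=; rewrite -[in RHS](cK v) -TT' comp_c.
by rewrite cK.
Qed.

End Transport.

Lemma spectrum_comp (R : realType) (V W : choiceType) (e : W -> V) (c : V -> W)
    (T : (V -> Cplx R) -> V -> Cplx R) (T' : (W -> Cplx R) -> W -> Cplx R) :
  cancel e c -> cancel c e -> (forall psi w, T' (psi \o e) w = T psi (e w)) ->
  spectrum T = spectrum T'.
Proof.
move=> eK cK TT'; rewrite /spectrum; congr (~` _); apply/seteqP; split.
  exact: (resolvent_set_comp eK cK TT').
apply: (resolvent_set_comp cK eK) => phi v.
rewrite -[in LHS](cK v) -TT'; congr (T' _ _).
by apply/funext => w /=; rewrite eK.
Qed.

Section Lattice.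
Variable R : realType.

Definition vertex (x : int * int) : tri_vertex R :=
  SigSub (mem_set (ex_intro _ x.1 (ex_intro _ x.2 erefl) :
    tri_lattice (tri_a1 R *~ x.1 + tri_a2 R *~ x.2))).

Lemma val_vertex x : set_val (vertex x) = tri_a1 R *~ x.1 + tri_a2 R *~ x.2.
Proof. by []. Qed.

Lemma pair_mulrz (p : R * R) (n : int) : p *~ n = (p.1 *~ n, p.2 *~ n).
Proof.
have h (m : nat) : p *+ m = (p.1 *+ m, p.2 *+ m).
  by elim: m => [//|m IH]; rewrite !mulrS IH.
by case: n => m; rewrite ?NegzE ?mulrNz -!pmulrn h.
Qed.

Lemma val_vertexE x : set_val (vertex x) =
  (x.1%:~R + x.2%:~R / 2, x.2%:~R * (2^-1 * Num.sqrt 3)).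
Proof.
rewrite val_vertex !pair_mulrz /tri_a1 /tri_a2 /=; congr (_, _) => /=.
  by rewrite -[2^-1 *~ _]mulrzl.
by rewrite mul0rz add0r mulrzl.
Qed.

Lemma vertex_inj : injective vertex.
Proof.
move=> x y /(congr1 set_val); rewrite !val_vertexE => -[e1 e2].
have s3 : 2^-1 * Num.sqrt 3 != 0 :> R by rewrite mulf_neq0 // gt_eqF // sqrtr_gt0.
move/(mulIf s3): e2 => e2; move: e1; rewrite e2 => /addIr /intr_inj e1.
by case: x y e1 e2 => [a b] [a' b'] /= -> /intr_inj ->.
Qed.

Lemma vertex_surj (u : tri_vertex R) : exists x, vertex x = u.
Proof.
case: u => p Hp; have [n [m e]] := set_mem Hp.
by exists (n, m); apply: val_inj; rewrite /= e.
Qed.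

Definition coords (u : tri_vertex R) : int * int := sval (cid (vertex_surj u)).

Lemma coordsK : cancel coords vertex.
Proof. by move=> u; rewrite /coords; case: cid. Qed.

Lemma vertexK : cancel vertex coords.
Proof. by move=> x; apply: vertex_inj; rewrite coordsK. Qed.

Definition steps : seq (int * int) :=
  [:: step1; - step1; step2; - step2; step3; - step3].

(** The form is the squared length of [n a_1 + m a_2]; being positive definite, it confines both
    coordinates to [-1, 0, 1]. *)
Lemma steps_quad (n m : int) : n ^+ 2 + n * m + m ^+ 2 = 1 <-> (n, m) \in steps.
Proof.
split=> [e|]; last by rewrite !inE => /or4P[|||/orP[|/orP[]]] // /eqP[-> ->].
have n1 : (absz n <= 1)%N by nia.
have m1 : (absz m <= 1)%N by nia.
have : n \in [:: 0; 1; -1 : int] by rewrite !inE; lia.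
have : m \in [:: 0; 1; -1 : int] by rewrite !inE; lia.
by rewrite !inE => /or3P[] /eqP em /or3P[] /eqP en; move: e; rewrite em en.
Qed.

Lemma tri_adj_vertex x y : tri_adj (vertex x) (vertex y) <-> y - x \in steps.
Proof.
rewrite /tri_adj /euclid_dist !val_vertexE /=.
set X := (X in Num.sqrt X = 1).
have XE : X = ((y.1 - x.1) ^+ 2 + (y.1 - x.1) * (y.2 - x.2) + (y.2 - x.2) ^+ 2 : int)%:~R.
  rewrite /X -mulrBl exprMn exprMn sqr_sqrtr // !rmorphD !rmorphXn !rmorphM /= !rmorphB /=.
  by field.
have -> : (y - x) = (y.1 - x.1, y.2 - x.2) by [].
rewrite -steps_quad; split=> [e|e]; last by rewrite XE e sqrtr1.
have X0 : 0 <= X by rewrite addr_ge0 ?sqr_ge0.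
have : X = 1 by rewrite -(sqr_sqrtr X0) e expr1n.
by rewrite XE => /eqP; rewrite -[1]/(1%:~R) eqr_int => /eqP.
Qed.

Lemma tri_laplacian_vertex (psi : tri_vertex R -> Cplx R) x :
  tri_laplacian psi (vertex x) = \sum_(s <- steps) psi (vertex (x + s)).
Proof.
have -> : tri_laplacian psi (vertex x) =
    \sum_(v \in [set` [seq vertex (x + s) | s <- steps]]) psi v.
  rewrite /tri_laplacian; apply: eq_fsbigl.
  apply/seteqP; split=> [v|v] /=.
    rewrite -(coordsK v) => /tri_adj_vertex h; rewrite -(subrK x (coords v)) addrC.
    exact: (map_f (fun s => vertex (x + s)) h).
  move=> /(@mapP _ _ (fun s => vertex (x + s)) steps)[s sP ->].
  by apply/tri_adj_vertex; rewrite addrAC subrr add0r.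
rewrite -fsbig_seq ?big_map //.
by rewrite map_inj_uniq // => s t /vertex_inj/addrI.
Qed.

Definition triQ (u : tri_vertex R) : R :=
  if cls (coords u) == (false, false) then -1 else 0.

Lemma triQ_periodic : tri_periodic 2 2 triQ.
Proof.
split=> u v; rewrite -(coordsK u) -(coordsK v) /triQ !vertexK.
  move=> e; suff -> : coords v = coords u + (2, 0) by rewrite /cls /= !oddzD /= !addbF.
  by apply: vertex_inj; apply: val_inj;
  rewrite [LHS]e !val_vertex /= addr0 mulrzDr addrAC.
move=> e; suff -> : coords v = coords u + (0, 2) by rewrite /cls /= !oddzD /= !addbF.
by apply: vertex_inj; apply: val_inj;
  rewrite [LHS]e !val_vertex /= addr0 mulrzDr [RHS]addrA.
Qed.

Lemma spectrum_vertex (lam : R) :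
  spectrum (schrodinger (fun u => lam * triQ u)) = spectrum (chopw (potential lam)).
Proof.
apply: (spectrum_comp vertexK coordsK) => psi x.
rewrite /schrodinger tri_laplacian_vertex /chopw /triQ vertexK /potential.
congr (_ + Cinj _ * _); last by case: ifP => _; rewrite ?mulr1 ?mulrN1 ?mulr0 ?oppr0.
by rewrite !big_cons big_nil /= addr0 !addrA.
Qed.

End Lattice.

(** * Connected components *)

Section Components.
Variable R : realType.
Local Notation cinj := (@Cinj R : R -> Cplx R).

Lemma Cinj_continuous : continuous cinj.
Proof.
move=> x; apply/cvgrPdist_lt => e; rewrite ltcE /= => /andP[/eqP ei er].
near=> y.
rewrite -[Cinj x - Cinj y]rmorphB /= normc_def /= expr0n addr0 sqrtr_sqr.
rewrite ltcE /= ei eqxx /=.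
near: y; apply: (@cvgr_dist_lt _ _ _ _ _ id _ _ _ er); exact: cvg_id.
Unshelve. all: by end_near. Qed.

Definition CRe (z : Cplx R) : R := complex.Re z.

Lemma CRe_continuous : continuous CRe.
Proof.
move=> z; have zF : Filter (nbhs z) := nbhs_filter z.
apply/(@cvgrPdist_lt _ _ _ (nbhs z) zF CRe (CRe z)) => e e0.
have e0' : 0 < (e%:C)%C :> Cplx R by rewrite ltcR.
near=> y.
have : `|z - y| < (e%:C)%C :> Cplx R.
  near: y; apply: (@cvgr_dist_lt _ _ _ _ _ id _ _ _ e0'); exact: cvg_id.
rewrite -ltcR; apply: le_lt_trans.
by rewrite /CRe -raddfB normc_ge_Re.
Unshelve. all: by end_near. Qed.

(** A connected set meeting both images has an interval as its real projection, which would contain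
    [c]; the images themselves are connected. *)
Lemma components_two (I J : set R) (c : R) : is_interval I -> is_interval J ->
  I !=set0 -> J !=set0 -> (forall x, I x -> x < c) -> (forall x, J x -> c < x) ->
  (components (cinj @` (I `|` J)) #= `I_2)%card.
Proof.
move=> iI iJ [x0 Ix0] [y0 Jy0] Ic cJ.
set A := _ @` _.
have conn (K : set R) : is_interval K -> connected (cinj @` K).
  move=> /connected_intervalP Kc; apply: connected_continuous_connected => //.
  exact/continuous_subspaceT/Cinj_continuous.
have noc (K : set (Cplx R)) x y : connected K -> K `<=` A -> I x -> J y ->
    K (Cinj x) -> K (Cinj y) -> False.
  move=> Kc KA Ix Jy Kx Ky.
  have : connected (CRe @` K).
    apply: connected_continuous_connected => //.
    exact/continuous_subspaceT/CRe_continuous.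
  move=> /connected_intervalP /(_ x y) h.
  have hx : (CRe @` K) x by exists (Cinj x).
  have hy : (CRe @` K) y by exists (Cinj y).
  have [|z Kz zc] := h hx hy c.
    by rewrite !ltW ?Ic ?cJ.
  have [w [Iw|Jw] wz] := KA _ Kz; move: zc; rewrite -wz /= => wc.
    by have := Ic _ Iw; rewrite wc ltxx.
  by have := cJ _ Jw; rewrite wc ltxx.
have compI x : I x -> connected_component A (Cinj x) = cinj @` I.
  move=> Ix; apply/seteqP; split.
    move=> z Kz; have [w [Iw|Jw] wz] := connected_component_sub Kz; first by exists w.
    exfalso; apply: (noc _ x w (@component_connected _ A (Cinj x))) => //.
    - exact: connected_component_sub.
    - by apply: connected_component_refl; exists x => //; left.
    - by rewrite wz.
  apply: connected_component_max; [by exists x| |exact: conn].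
  by apply: image_subset => ?; left.
have compJ x : J x -> connected_component A (Cinj x) = cinj @` J.
  move=> Jx; apply/seteqP; split.
    move=> z Kz; have [w [Iw|Jw] wz] := connected_component_sub Kz; last by exists w.
    exfalso; apply: (noc _ w x (@component_connected _ A (Cinj x))) => //.
    - exact: connected_component_sub.
    - by rewrite wz.
    - by apply: connected_component_refl; exists x => //; right.
  apply: connected_component_max; [by exists x| |exact: conn].
  by apply: image_subset => ?; right.
have -> : components A = [set cinj @` I; cinj @` J].
  apply/seteqP; split=> [_ [_ [w [Iw|Jw] <-] <-]|K [->|->]].
  - by left; apply: compI.
  - by right; apply: compJ.
  - by exists (Cinj x0); [exists x0 => //; left|apply: compI].
  - by exists (Cinj y0); [exists y0 => //; right|apply: compJ].
have IJ : cinj @` I <> cinj @` J.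
  move=> e; have : (cinj @` I) (Cinj x0) by exists x0.
  rewrite e => -[w Jw [wx]]; have := Ic _ Ix0; have := cJ _ Jw.
  by rewrite wx => h /(lt_trans h); rewrite ltxx.
apply/card_esym/card_set_bijP.
exists (fun n => if n is 0 then cinj @` I else cinj @` J).
split.
- by move=> [|n] _ /=; [left|right].
- move=> [|[|m]] [|[|n]]; rewrite !inE //= => _ _ e; exfalso; apply: IJ => //.
- by move=> K [->|->]; [exists 0|exists 1].
Qed.

End Components.

(** * Identification of the spectrum with the Floquet bands *)

Section Spectrum.
Variable R : realType.
Local Notation cinj := (@Cinj R : R -> Cplx R).

(** Three cases: a zero of the determinant gives a damped Bloch wave; [eta != 0] makes the normal
    operator at least [eta^2]; for real energies off the bands, compactness bounds the determinant
    below and Plancherel turns this into the required lower bound. *)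
Lemma spectrum_band (lam : R) : spectrum (chopw (potential lam)) =
  cinj @` [set E | bandset lam (- 2 - E)].
Proof.
apply/seteqP; split=> [[E eta] zs|_ [E [a [b ab]] <-]]; last first.
  move: ab; rewrite -charpoly_band (_ : - 2 - (- 2 - E) = E); last by ring.
  by move=> /floquet_kernel[v [c [vc vk]]]; apply: weyl vc vk.
have [eta0|eta0] := eqVneq eta 0; last first.
  exfalso; apply: zs; apply: (@resolventP _ _ _ _ (eta ^+ 2)).
    by rewrite exprn_even_gt0.
  move=> k f fP; rewrite lerDr; apply: box_ge0 => x; exact: sqr_ge0.
rewrite eta0 in zs *; have [Eb|Eb] := pselect (bandset lam (- 2 - E)).
  by exists E.
exfalso; apply: zs; have [d d0 dle] := band_lower_bound Eb.
apply: (@resolventP _ _ _ _ ((d / (24 * (2 + `|lam| + `|E|) ^+ 3)) ^+ 2)).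
  by rewrite exprn_gt0 // divr_gt0 // mulr_gt0 // exprn_gt0 //.
move=> k f fP; rewrite expr0n mul0r addr0.
apply: (hopw_lower (w := fun c => potential lam c - E)) => // a b v ha hb.
apply: floquet_lower => //.
rewrite -[E in charpoly _ E](_ : - 2 - (- 2 - E) = E); last by ring.
by rewrite charpoly_band; apply: dle.
Qed.

End Spectrum.

Theorem theorem1p2 (R : realType) :
  exists Q : tri_vertex R -> R,
    tri_periodic 2 2 Q /\
    exists2 lambda0 : R, 0 < lambda0 &
      forall lambda : R, 0 < lambda -> lambda < lambda0 ->
        (components (spectrum (schrodinger (fun u => lambda * Q u))) #= `I_2)%card.
Proof.
exists (@triQ R); split; first exact: triQ_periodic.
(* The sign checks in [bandset_upper] and [bandset_pos] use [lam < 1]. *)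
exists 1 => // lam l0 l1; rewrite spectrum_vertex spectrum_band.
have l01 : 0 < lam < 1 by rewrite l0.
pose I : set R := [set E | 0 < - 2 - E /\ bandset lam (- 2 - E)].
pose J : set R := [set E | - 2 - E <= 0 /\ bandset lam (- 2 - E)].
have -> : [set E | bandset lam (- 2 - E)] = I `|` J.
  apply/seteqP; split=> [E /= EB|E [[]|[]] //].
  by have [h|h] := leP (- 2 - E) 0; [right|left].
(* The separating energy corresponds to [t = lam / 4], inside the gap [0 < t <= lam / 2]. *)
apply: (@components_two _ _ _ (- 2 - lam / 4)).
- move=> x y [x0 xB] [y0 yB] z /andP[xz zy]; split; first lra.
  by apply: (bandset_lower y0 yB xB); lra.
- move=> x y [x0 xB] [y0 yB] z /andP[xz zy]; split; first lra.
  by apply: (bandset_upper l01 yB); lra.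
- have [t t0 tB] := bandset_pos l01; exists (- 2 - t); rewrite /I /=.
  by rewrite (_ : - 2 - (- 2 - t) = t) //; ring.
- exists (- 2); rewrite /J /= subrr; split => //; exact: bandset0.
- move=> E [E0 EB]; rewrite ltNge; apply/negP => h.
  by apply: (bandset_gap E0 _ EB); lra.
- by move=> E [E0 _]; lra.
Qed.
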